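(* Let $X=(X_m)_{m\in\mathbb{Z}^d}$ be a strongly stationary field on $\mathbb{Z}^d$ taking values in a uniformly discrete set $U\subset\mathbb{C}$. Assume that the support of its spectral measure $S$ is contained in a simply connected subset of $\mathbb{T}^d$. Then $X$ is a.s. periodic, with a possibly random period. In particular, $S$ is a purely atomic measure. If $X$ is furthermore assumed to be ergodic, then $X$ is a.s. $N$-periodic for a deterministic period $N\in\mathbb{N}$, and the support of $S$ is finite.
   Context: $\mathbb{T}=\{e^{is}:s\in[-\pi,\pi)\}$. A random field on $\mathbb{Z}^d$ is a collection $X=(X_m)_{m\in\mathbb{Z}^d}$ of square integrable centred random variables; it is strongly stationary if the translated field $\tau_m X$ has the same law as $X$ for every $m\in\mathbb{Z}^d$. It is ergodic if $\mathbf{P}(X\in\Omega)\in\{0,1\}$ for every event $\Omega$ invariant under translations, i.e. with $\Omega=\{\tau_m\omega:\omega\in\Omega\}$ for every $m\in\mathbb{Z}^d$. The spectral measure $S$ of $X$ is the non-negative finite measure on $\mathbb{T}^d$ such that $\mathrm{Var}\big(\sum_m X_m f(m)\big)=(2\pi)^{-d}\int_{\mathbb{T}^d}|\hat f(u)|^2S(du)$ for every finitely supported $f$ on $\mathbb{Z}^d$, where $\hat f(u)=\sum_{k\in\mathbb{Z}^d}u^kf(k)$ and $u^k=u_1^{k_1}\cdots u_d^{k_d}$. A set $U\subset\mathbb{C}$ is uniformly discrete if $\inf_{z,z'\in U,\,z\neq z'}|z-z'|>0$. A path-connected set $G\subset\mathbb{T}^d$ is simply connected if for every continuous $\gamma:[0,1]\to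 G$ with $\gamma(0)=\gamma(1)$ there is a continuous map $T:[0,1]^2\to G$ with $T(0,\cdot)=\gamma$, $T(a,0)=T(a,1)$ for all $a$, and $T(1,\cdot)$ constant. Let $\mathbb{Z}_+$ denote the positive integers. A deterministic array $(x_m)_{m\in\mathbb{Z}^d}$ is $N$-periodic, for $N\in\mathbb{Z}_+^d$, if $x_{m+N}=x_m$ for all $m\in\mathbb{Z}^d$; for a positive integer $N$, $N$-periodic means $(N,\dots,N)$-periodic. Periodic means $N$-periodic for some $N\in\mathbb{Z}_+^d$. *)

(* Defs.v *)
From HB Require Import structures.
From mathcomp Require Import all_boot all_order all_algebra.
From mathcomp Require Import all_classical all_reals all_analysis.
From mathcomp Require Import complex.

Set Implicit Arguments.
Unset Strict Implicit.
Unset Printing Implicit Defensive.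

Import Order.TTheory GRing.Theory Num.Theory numFieldNormedType.Exports.
Local Open Scope classical_set_scope.
Local Open Scope ring_scope.
Local Open Scope complex_scope.

(* The topology of the modulus: balls have radius e : R[i] with 0 < e, which
   forces e to be real. *)
HB.instance Definition _ (R : realType) := NormedModule.copy R[i] R[i]^o.

Notation modulus := ComplexField.Normc.normc.
Notation borel T := (g_sigma_algebraType (@open T)).

Definition circle (R : realType) : set R[i] :=
  [set cos s +i* sin s | s in [set s : R | - pi <= s < pi]].

Definition torus (R : realType) (d : nat) : Type :=
  set_type [set u : 'rV[R[i]]_d | forall j, circle (u 0 j)].

HB.instance Definition _ (R : realType) (d : nat) :=
  Topological.on (torus R d).

Lemma torus_one (R : realType) (d : nat) :
  (const_mx 1 : 'rV[R[i]]_d) \in [set u : 'rV[R[i]]_d | forall j, circle (u 0 j)].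
Proof.
apply/mem_set => j /=; exists 0; last by rewrite cos0 sin0 mxE.
by rewrite /= oppr_le0 pi_ge0 pi_gt0.
Qed.

(* A base point is required to build the Borel measurable space. *)
HB.instance Definition _ (R : realType) (d : nat) :=
  isPointed.Build (torus R d) (exist _ (const_mx 1) (torus_one R d)).

Definition torus_exp (R : realType) (d : nat) (u : torus R d)
    (k : 'rV[int]_d) : R[i] :=
  \prod_(j < d) (set_val u 0 j) ^ (k 0 j).

Definition fourier (R : realType) (d : nat) (f : 'rV[int]_d -> R[i])
    (u : torus R d) : R[i] :=
  \sum_(k \in [set: 'rV[int]_d]) torus_exp u k * f k.

Section complex_random_variables.
Context d0 (T : measurableType d0) (R : realType) (P : probability T R).
Local Open Scope ereal_scope.

Definition cmean (Y : T -> R[i]) : R[i] :=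
  fine 'E_P[fun w => complex.Re (Y w)] +i* fine 'E_P[fun w => complex.Im (Y w)].

Definition cvariance (Y : T -> R[i]) : \bar R :=
  'E_P[fun w => (modulus (Y w - cmean Y) ^+ 2)%R].

End complex_random_variables.

(* Product sigma-algebra on the space of complex arrays indexed by Z^d. *)
Definition cylinders (R : realType) (d : nat) :
    set (set ('rV[int]_d -> R[i])) :=
  [set A | exists m, exists2 B : set (borel R[i]),
    measurable B & A = [set x | B (x m)]].

Notation array_space R d := (g_sigma_algebraType (@cylinders R d)).

Definition translate (R : realType) (d : nat) (m : 'rV[int]_d)
    (x : 'rV[int]_d -> R[i]) : 'rV[int]_d -> R[i] :=
  fun n => x (n + m).

Definition uniformly_discrete (R : realType) (U : set R[i]) : Prop :=
  (0 < ereal_inf [set e : \bar R | exists z z', [/\ U z, U z', z != z' &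
                                     e = (modulus (z - z'))%:E]])%E.

Section random_fields.
Context d0 (T : measurableType d0) (R : realType) (P : probability T R).
Context (d : nat) (X : 'rV[int]_d -> T -> R[i]).

Definition sample (w : T) : array_space R d := fun m => X m w.

Definition random_field : Prop := forall m : 'rV[int]_d,
  [/\ measurable_fun [set: T] (X m : T -> borel R[i]),
      ('E_P[fun w => (modulus (X m w) ^+ 2)%R] < +oo)%E &
      cmean P (X m) = 0].

Definition strongly_stationary : Prop :=
  forall (m : 'rV[int]_d) (A : set (array_space R d)), measurable A ->
    pushforward P (fun w => translate m (sample w) : array_space R d) A =
    pushforward P sample A.

Definition ergodic : Prop :=
  forall A : set (array_space R d), measurable A ->
    (forall m : 'rV[int]_d, A = [set translate m x | x in A]) ->
    P (sample @^-1` A) = 0%E \/ P (sample @^-1` A) = 1%E.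

Definition is_spectral_measure
    (S : {finite_measure set (borel (torus R d)) -> \bar R}) : Prop :=
  forall f : 'rV[int]_d -> R[i], finite_set [set m | f m != 0] ->
    cvariance P (fun w => \sum_(m \in [set: 'rV[int]_d]) X m w * f m) =
  (((2 * pi) ^- d)%:E * \int[S]_u ((modulus (fourier f u) ^+ 2)%R)%:E)%E.

End random_fields.

Definition measure_support (R : realType) (T : ptopologicalType)
    (S : {measure set (borel T) -> \bar R}) : set T :=
  [set u | forall A : set T, open A -> A u -> (0 < S A)%E].

(* Atoms are points of positive mass: on T^d every atom of a finite Borel
   measure is, up to a null set, such a point. *)
Definition purely_atomic (R : realType) (T : ptopologicalType)
    (S : {measure set (borel T) -> \bar R}) : Prop :=
  forall A : set (borel T), measurable A -> (0 < S A)%E ->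
    exists2 u, A u & (0 < S [set u])%E.

Definition path_connected (R : realType) (T : topologicalType) (G : set T)
    : Prop :=
  forall x y, G x -> G y -> exists p : R -> T,
    [/\ {within `[0, 1], continuous p}, p @` `[0, 1] `<=` G,
        p 0 = x & p 1 = y].

(* The interval [0, 1] is that of R, which must be given explicitly. *)
Definition simply_connected (R : realType) (T : topologicalType) (G : set T)
    : Prop :=
  path_connected R G /\
  forall gamma : R -> T, {within `[0, 1], continuous gamma} ->
    gamma @` `[0, 1] `<=` G -> gamma 0 = gamma 1 ->
    exists H : R * R -> T,
      [/\ {within `[0, 1] `*` `[0, 1], continuous H},
          H @` (`[0, 1] `*` `[0, 1]) `<=` G,
          (forall t, t \in `[0, 1] -> H (0, t) = gamma t),
          (forall a, a \in `[0, 1] -> H (a, 0) = H (a, 1)) &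
          exists c, forall t, t \in `[0, 1] -> H (1, t) = c].

Definition is_N_periodic (A : Type) (d : nat) (N : 'rV[int]_d)
    (x : 'rV[int]_d -> A) : Prop :=
  forall m, x (m + N) = x m.

Definition is_periodic (A : Type) (d : nat) (x : 'rV[int]_d -> A) : Prop :=
  exists2 N : 'rV[int]_d, forall j, 0 < N 0 j & is_N_periodic N x.

(* Main.v *)
(* The law of X is shown to be purely atomic; the orbit of an atom under translations
   carries equal masses, hence is finite, and X is periodic.

   Let K be the support of S. A simply connected set contains no closed line
   u exp(i s v), with v a non-zero integer vector, since such a loop winds around a
   coordinate. This is used as follows: for every real direction e <> 0 there is a
   trigonometric polynomial F with frequencies in {t . e < 0} and |1 + F| <= rho < 1
   on K. Indeed, if g is a real trigonometric polynomial without frequencies orthogonal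
   to e and g < 0 on K, then g is the real part of some G with frequencies in
   {t . e < 0}, and F = eps G works for small eps. To get g, one removes from high powers
   of functions peaking at points off K their mean along the flow of direction e: this
   mean is bounded below by counting frequencies, whereas the powers are exponentially
   small on K.

   By compactness F can be chosen with uniform bounds when e varies in the unit sphere.
   Multiplying the monomial of exponent m by a power of 1 + F proportional to |m|, with
   e = m / |m|, approximates it on K, with an error exponentially small in |m|, by
   monomials of exponents shorter than m. Hence X_m is predicted by the X_t with
   |t| < |m| up to an exponentially small variance. As the values of X are uniformly
   separated, by Borel-Cantelli X is a.s. determined by its restriction to some finite
   box, so it takes a.s. countably many values.

   Finally, if X is N-periodic outside an event of small energy, then the increments
   X_0 - X_(k N e_j) have small variances, while the average over k of their spectral
   densities |1 - u_j^(k N)|^2 is bounded below where u_j^N <> 1; hence S is carried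
   by torsion points. *)
Require Import Defs.
From mathcomp Require Import all_boot all_order all_algebra.
From mathcomp Require Import all_classical all_reals all_analysis.
From mathcomp Require Import complex.
From mathcomp Require Import measurable_realfun.
From mathcomp Require Import ring lra zify.

Set Implicit Arguments.
Unset Strict Implicit.
Unset Printing Implicit Defensive.

Import Order.TTheory GRing.Theory Num.Theory numFieldNormedType.Exports.
Local Open Scope classical_set_scope.
Local Open Scope ring_scope.

(** * Bounds on the complex modulus *)

Section modulus.
Variable R : realType.
Implicit Types z : R[i].

Lemma sqr_modulus z : modulus z ^+ 2 = complex.Re z ^+ 2 + complex.Im z ^+ 2.
Proof. by case: z => x y /=; rewrite sqr_sqrtr// addr_ge0// sqr_ge0. Qed.

Lemma modulus_ge0 z : 0 <= modulus z.
Proof. by case: z => x y /=; exact: sqrtr_ge0. Qed.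

Lemma modulusD z w : modulus (z + w) <= modulus z + modulus w.
Proof. exact: le_normcD. Qed.

Lemma modulusX z n : modulus (z ^+ n) = modulus z ^+ n.
Proof.
elim: n => [|n IHn]; last by rewrite !exprS ComplexField.Normc.normcM IHn.
by rewrite !expr0 ComplexField.Normc.normc1.
Qed.

Lemma normRe_le_modulus (w : R[i]) : `|complex.Re w| <= modulus w.
Proof.
rewrite -(ler_pXn2r (ltn0Sn 1)) ?nnegrE ?modulus_ge0//.
by rewrite real_normK ?num_real// sqr_modulus lerDl sqr_ge0.
Qed.

Lemma Re_le_modulus (w : R[i]) : complex.Re w <= modulus w.
Proof. exact: le_trans (ler_norm _) (normRe_le_modulus _). Qed.

Lemma Im_le_modulus (w : R[i]) : `|complex.Im w| <= modulus w.
Proof.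
rewrite -(ler_pXn2r (ltn0Sn 1)) ?nnegrE ?modulus_ge0//.
by rewrite real_normK ?num_real// sqr_modulus lerDr sqr_ge0.
Qed.

Lemma modulus_le (w : R[i]) : modulus w <= `|complex.Re w| + `|complex.Im w|.
Proof.
rewrite -(ler_pXn2r (ltn0Sn 1)) ?nnegrE ?modulus_ge0 ?addr_ge0//.
by rewrite sqr_modulus sqrrD !real_normK ?num_real// [leRHS]addrAC lerDl mulrn_wge0 ?mulr_ge0.
Qed.

End modulus.

(** * Resonant and analytic parts of a squared modulus *)

Section resonances.
Variables (R : realType) (I : finType).

Lemma sqr_sum_le_card (f : I -> R) : (\sum_k f k) ^+ 2 <= #|I|%:R * \sum_k f k ^+ 2.
Proof.
have H : \sum_k \sum_l (f k * f l *+ 2) <= \sum_k \sum_l (f k ^+ 2 + f l ^+ 2).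
  apply: ler_sum => k _; apply: ler_sum => l _.
  by have := sqr_ge0 (f k - f l); rewrite sqrrB; lra.
have E1 : \sum_k \sum_l (f k * f l *+ 2) = (\sum_k f k) ^+ 2 *+ 2.
  rewrite expr2 mulr_suml -sumrMnl; apply: eq_bigr => k _.
  by rewrite mulr_sumr -sumrMnl.
have E2 : \sum_k \sum_l (f k ^+ 2 + f l ^+ 2) = (#|I|%:R * \sum_k f k ^+ 2) *+ 2.
  under eq_bigr do rewrite big_split /= sumr_const.
  by rewrite big_split /= sumr_const mulr2n mulr_natl -sumrMnl.
by move: H; rewrite E1 E2 lerMn2r.
Qed.

(** Cauchy-Schwarz for the sums of [f] over the classes of equal [tau]: there are at most [#|I|]
    classes, and the double sum adds up the squares of the class sums. *)
Lemma sqr_sum_le_resonant (tau f : I -> R) :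
  (\sum_k f k) ^+ 2 <=
  #|I|%:R * \sum_k \sum_(l | tau k == tau l) f k * f l.
Proof.
(* [r k] represents the class of [k], so that classes are indexed by [I]; the default is never
   reached, as [k] lies in its own class. *)
pose r k := odflt k [pick l | tau k == tau l].
have tau_r k : tau (r k) = tau k.
  by rewrite /r; case: pickP => [l /eqP|].
have rP k l : (tau k == tau l) = (r k == r l).
  apply/eqP/eqP => [kl|/(congr1 tau)]; last by rewrite !tau_r.
  rewrite /r kl; case: pickP => [//|/(_ l)]; by rewrite eqxx.
pose s j := \sum_(k | r k == j) f k.
have -> : \sum_k f k = \sum_j s j by rewrite (partition_big r predT).
apply: le_trans (sqr_sum_le_card _) _.
apply: ler_wpM2l; first exact: ler0n.
rewrite le_eqVlt; apply/orP; left; apply/eqP.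
rewrite [RHS](partition_big r predT)//=; apply: eq_bigr => j _.
rewrite expr2 {1}/s mulr_suml; apply: eq_bigr => k /eqP kj.
rewrite mulr_sumr; apply: eq_bigl => l.
by rewrite rP kj eq_sym.
Qed.

Variables (tau : I -> R) (z : I -> R[i]).

(* With z k = c k u^(t k) and tau k = t k . e, |sum z|^2 splits into its mean along
   the flow of direction e and the real part of a sum of monomials of frequency
   t with t . e < 0. *)
Definition resonant_part : R :=
  \sum_k \sum_(l | tau k == tau l) complex.Re (z k * (z l)^*%C).

Definition analytic_part : R[i] :=
  2 * \sum_k \sum_(l | tau k < tau l) z k * (z l)^*%C.

Let Re_mulJ (a b : R[i]) : complex.Re (a * b^*%C) =
  complex.Re a * complex.Re b + complex.Im a * complex.Im b.
Proof. by case: a b => [a1 a2] [b1 b2] /=; rewrite mulrN opprK. Qed.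

Let ReM2 (a : R[i]) : complex.Re (2 * a) = 2 * complex.Re a.
Proof. by rewrite mulr_natl mulr2n; case: a => a b /=; ring. Qed.

Lemma Re_sum (J : Type) (s : seq J) (Q : pred J) (F : J -> R[i]) :
  complex.Re (\sum_(j <- s | Q j) F j) = \sum_(j <- s | Q j) complex.Re (F j).
Proof. exact: (raddf_sum (@complex.Re R : Rcomplex R -> R)). Qed.

Lemma Im_sum (J : Type) (s : seq J) (Q : pred J) (F : J -> R[i]) :
  complex.Im (\sum_(j <- s | Q j) F j) = \sum_(j <- s | Q j) complex.Im (F j).
Proof. exact: (raddf_sum (@complex.Im R : Rcomplex R -> R)). Qed.

Lemma resonant_part_ge : modulus (\sum_k z k) ^+ 2 <= #|I|%:R * resonant_part.
Proof.
rewrite sqr_modulus Re_sum Im_sum.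
apply: le_trans (lerD (sqr_sum_le_resonant tau _) (sqr_sum_le_resonant tau _)) _.
rewrite -mulrDr ler_wpM2l// -big_split /= /resonant_part; rewrite le_eqVlt; apply/orP; left; apply/eqP.
apply: eq_bigr => k _; rewrite -big_split; apply: eq_bigr => l _ /=.
by rewrite Re_mulJ.
Qed.

(** Exchanging [k] and [l] conjugates the summand, so the pairs with [tau k < tau l] and those with
    [tau l < tau k] contribute equally; hence the factor 2 in [analytic_part]. *)
Lemma Re_analytic_part :
  complex.Re analytic_part = modulus (\sum_k z k) ^+ 2 - resonant_part.
Proof.
pose g k l := complex.Re (z k * (z l)^*%C).
have gC k l : g k l = g l k by rewrite /g !Re_mulJ; ring.
have -> : modulus (\sum_k z k) ^+ 2 = \sum_k \sum_l g k l.
  rewrite sqr_modulus Re_sum Im_sum !expr2 !mulr_suml -big_split.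
  apply: eq_bigr => k _; rewrite !mulr_sumr -big_split.
  by apply: eq_bigr => l _; rewrite /g Re_mulJ.
have -> : \sum_k \sum_l g k l = \sum_k \sum_(l | tau k < tau l) g k l
     + \sum_k \sum_(l | tau k == tau l) g k l + \sum_k \sum_(l | tau l < tau k) g k l.
  rewrite -!big_split; apply: eq_bigr => k _ /=.
  rewrite (bigID (fun l => tau k < tau l)) /= -addrA; congr (_ + _).
  rewrite (bigID (fun l => tau k == tau l)) /=; congr (_ + _).
    by apply: eq_bigl => l; case: (ltgtP (tau k) (tau l)).
  by apply: eq_bigl => l; case: (ltgtP (tau k) (tau l)).
have -> : \sum_k \sum_(l | tau l < tau k) g k l = \sum_k \sum_(l | tau k < tau l) g k l.
  rewrite (exchange_big_dep predT) //=; apply: eq_bigr => k _.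
  by apply: eq_bigr => l _.
rewrite /analytic_part ReM2 Re_sum.
under eq_bigr do rewrite Re_sum.
rewrite /resonant_part -/g; lra.
Qed.

End resonances.

Local Open Scope complex_scope.

(** * Characters and trigonometric polynomials on the torus *)

Section cis.
Variable R : realType.
Implicit Types x y : R.

Definition cis x : R[i] := cos x +i* sin x.

Lemma cis0 : cis 0 = 1.
Proof. by rewrite /cis cos0 sin0. Qed.

Lemma cisD x y : cis (x + y) = cis x * cis y.
Proof. by apply/eqP; rewrite /cis cosD sinD eq_complex /= addrC eqxx /= addrC [_ * cos y]mulrC. Qed.

Lemma modulus_cis x : modulus (cis x) = 1.
Proof. by rewrite /cis /= cos2Dsin2 sqrtr1. Qed.

Lemma cis_neq0 x : cis x != 0.
Proof.
apply/eqP => x0; have := modulus_cis x.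
by rewrite x0 ComplexField.Normc.normc0 => /esym/eqP; rewrite oner_eq0.
Qed.

Lemma cisN x : cis (- x) = (cis x)^-1.
Proof.
by apply: (mulfI (cis_neq0 x)); rewrite -cisD subrr cis0 divff// cis_neq0.
Qed.

Lemma conj_cis x : (cis x)^*%C = cis (- x).
Proof. by rewrite /cis cosN sinN. Qed.

Lemma conjcM (a b : R[i]) : (a * b)^*%C = a^*%C * b^*%C.
Proof. exact: rmorphM. Qed.

Lemma cisXz x (k : int) : cis x ^ k = cis (k%:~R * x).
Proof.
have H y n : cis y ^+ n = cis (n%:R * y).
  elim: n => [|n IHn]; first by rewrite expr0 mul0r cis0.
  by rewrite exprS IHn -cisD -add1n natrD mulrDl mul1r.
case: k => n; first by rewrite -exprnP H.
by rewrite NegzE -exprz_inv -exprnP -cisN H mulrN mulrNz mulNr.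
Qed.

Lemma cis_sum (J : Type) (s : seq J) (F : J -> R) :
  cis (\sum_(j <- s) F j) = \prod_(j <- s) cis (F j).
Proof. by apply: (big_morph cis cisD cis0). Qed.

Lemma cis2piz (k : int) : cis (2 * pi * k%:~R) = 1.
Proof.
have H : cis (2 * pi) = 1 by rewrite /cis mulr_natl cos2pi sin2pi.
by rewrite mulrC -cisXz H exp1rz.
Qed.

(** The angle is reduced to [acos (cos x)] with the sign of [sin x]; the value [pi], excluded from
    [circle], is replaced by [- pi]. *)
Lemma circle_cis x : circle (cis x).
Proof.
have [c1 c2] := (cos_geN1 x, cos_le1 x).
have a1 : -1 <= cos x <= 1 by rewrite c1 c2.
have pi0 := pi_gt0 R.
have sa : sin (acos (cos x)) = `|sin x|.
  by rewrite sin_acos// -sqrtr_sqr -sin2cos2.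
have [s0|s0] := lerP 0 (sin x); last first.
  exists (- acos (cos x)); last first.
    by rewrite cosN sinN acosK// sa ltr0_norm// opprK.
  rewrite /= lerN2 acos_lepi//= (le_lt_trans _ pi0)//.
  by rewrite oppr_le0 acos_ge0.
have [ap|ap] := ltP (acos (cos x)) pi.
  exists (acos (cos x)); last by rewrite acosK// sa ger0_norm.
  by rewrite /= ap andbT (le_trans _ (acos_ge0 a1))// oppr_le0 ltW.
have E : acos (cos x) = pi by apply/le_anti; rewrite ap acos_lepi.
exists (- pi); first by rewrite /= lexx/= (lt_trans _ pi0)// oppr_lt0.
rewrite cosN sinN -E acosK// sa; congr (_ +i* _).
by rewrite -sa E sinpi oppr0; move: sa; rewrite E sinpi ger0_norm.
Qed.

End cis.

Section torus_coordinates.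
Variables (R : realType) (d : nat).
Implicit Types (th : 'rV[R]_d) (k : 'rV[int]_d) (u : torus R d).

Definition dotz k th : R := \sum_j (k 0 j)%:~R * th 0 j.

Lemma tor_subproof th :
  (\row_j cis (th 0 j)) \in [set u : 'rV[R[i]]_d | forall j, circle (u 0 j)].
Proof. by apply/mem_set => j; rewrite mxE; exact: circle_cis. Qed.

Definition tor th : torus R d := exist _ (\row_j cis (th 0 j)) (tor_subproof th).

Lemma torE th j : set_val (tor th) 0 j = cis (th 0 j).
Proof. by rewrite mxE. Qed.

(** The angles lie in one compact cube, from which the torus inherits compactness. *)
Lemma tor_surj u : exists2 th, tor th = u & forall j, -pi <= th 0 j <= pi.
Proof.
have H j : exists s : R, (-pi <= s < pi) && (cis s == set_val u 0 j).
  have /set_mem/(_ j)[s /= sp E] := valP u.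
  by exists s; rewrite sp /= -E.
exists (\row_j xchoose (H j)).
  apply/val_inj/rowP => j; rewrite torE mxE.
  by have /andP[_ /eqP] := xchooseP (H j).
move=> j; rewrite mxE; have /andP[/andP[a b] _] := xchooseP (H j).
by rewrite a ltW.
Qed.

Lemma torus_exp_tor th k : torus_exp (tor th) k = cis (dotz k th).
Proof.
rewrite /dotz cis_sum; apply: eq_bigr => j _.
by rewrite torE cisXz.
Qed.

Lemma dotzDl k l th : dotz (k + l) th = dotz k th + dotz l th.
Proof.
by rewrite -big_split; apply: eq_bigr => j _; rewrite mxE intrD mulrDl.
Qed.

Lemma dotzNl k th : dotz (- k) th = - dotz k th.
Proof.
by rewrite -sumrN; apply: eq_bigr => j _; rewrite mxE intrN mulNr.
Qed.

Lemma dotzDr k th th' : dotz k (th + th') = dotz k th + dotz k th'.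
Proof. by rewrite -big_split; apply: eq_bigr => j _; rewrite mxE mulrDr. Qed.

Lemma dotzZr k a th : dotz k (a *: th) = a * dotz k th.
Proof. by rewrite mulr_sumr; apply: eq_bigr => j _; rewrite mxE mulrCA. Qed.

Lemma torus_expD u k l : torus_exp u (k + l) = torus_exp u k * torus_exp u l.
Proof.
by have [th <- _] := tor_surj u; rewrite !torus_exp_tor dotzDl cisD.
Qed.

Lemma conj_torus_exp u k : (torus_exp u k)^*%C = torus_exp u (- k).
Proof.
by have [th <- _] := tor_surj u; rewrite !torus_exp_tor dotzNl conj_cis.
Qed.

Lemma torus_exp0 u : torus_exp u 0 = 1.
Proof. by rewrite /torus_exp big1// => j _; rewrite mxE expr0z. Qed.

Lemma modulus_torus_exp u k : modulus (torus_exp u k) = 1.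
Proof. by have [th <- _] := tor_surj u; rewrite torus_exp_tor modulus_cis. Qed.

End torus_coordinates.

Section trigonometric_polynomials.
Variables (R : realType) (d : nat).
Implicit Types (E : set 'rV[int]_d) (f g : torus R d -> R[i]).

(** Trigonometric polynomials with frequencies in [E]. Frequencies may repeat in the list, so sums
    and products require no collection of terms. *)
Definition trig E f := exists2 s : seq (R[i] * 'rV[int]_d),
  (forall p, p \in s -> E p.2) &
  forall u, f u = \sum_(p <- s) p.1 * torus_exp u p.2.

Lemma eq_trig E f g : f =1 g -> trig E f -> trig E g.
Proof. by move=> fg [s sE fE]; exists s => // u; rewrite -fg. Qed.

Lemma trigS E E' f : E `<=` E' -> trig E f -> trig E' f.
Proof. by move=> EE' [s sE fE]; exists s => // p /sE /EE'. Qed.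

Lemma trig0 E : trig E (fun=> 0).
Proof. by exists [::] => // u; rewrite big_nil. Qed.

Lemma trig1 E c k : E k -> trig E (fun u => c * torus_exp u k).
Proof.
move=> Ek; exists [:: (c, k)] => [p|u]; first by rewrite inE => /eqP ->.
by rewrite big_seq1.
Qed.

Lemma trigD E f g : trig E f -> trig E g -> trig E (fun u => f u + g u).
Proof.
move=> [s sE fE] [s' s'E gE]; exists (s ++ s').
  by move=> p; rewrite mem_cat => /orP[/sE|/s'E].
by move=> u; rewrite big_cat fE gE.
Qed.

Lemma trigM E E' E'' f g : (forall k l, E k -> E' l -> E'' (k + l)) ->
  trig E f -> trig E' g -> trig E'' (fun u => f u * g u).
Proof.
move=> EE [s sE fE] [s' s'E gE].
exists [seq (p.1 * q.1, p.2 + q.2) | p <- s, q <- s'].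
  by move=> p /allpairsP[[a b] /= [/sE Ea /s'E Eb ->]]; exact: EE.
move=> u; rewrite fE gE big_allpairs_dep mulr_suml; apply: eq_bigr => p _.
rewrite mulr_sumr; apply: eq_bigr => q _ /=.
by rewrite torus_expD mulrACA.
Qed.

Lemma trigZ E c f : trig E f -> trig E (fun u => c * f u).
Proof.
move=> fE; have H := @trig1 [set 0] c 0 erefl.
have := @trigM [set 0] E E _ _ _ H fE.
have EE (k l : 'rV[int]_d) : [set 0] k -> E l -> E (k + l) by move=> ->; rewrite add0r.
by move=> /(_ EE); apply: eq_trig => u; rewrite torus_exp0 mulr1.
Qed.

Lemma trig_sum E (J : Type) (s : seq J) (Q : pred J) (F : J -> torus R d -> R[i]) :
  (forall j, Q j -> trig E (F j)) -> trig E (fun u => \sum_(j <- s | Q j) F j u).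
Proof.
move=> FE; elim: s => [|j s IHs].
  by apply: eq_trig (trig0 E) => u; rewrite big_nil.
have [Qj|Qj] := boolP (Q j); last first.
  by apply: eq_trig IHs => u; rewrite big_cons (negbTE Qj).
by apply: eq_trig (trigD (FE _ Qj) IHs) => u; rewrite big_cons Qj.
Qed.

End trigonometric_polynomials.

(** * Peak functions and the splitting of their powers *)

Section peak.
Variables (R : realType) (d : nat).
Implicit Types (u : torus R d) (phi th : 'rV[R]_d).

(** The product over the coordinates of [cos ^ 2] of half the angle from [phi] to [u]: it lies in
    [[0, 1]] and equals 1 only at [tor phi]. *)
Definition peak phi u : R :=
  \prod_j modulus ((1 + cis (- phi 0 j) * set_val u 0 j) / 2) ^+ 2.

(* [A] is the resonant part of [peak phi ^+ n]. Counting frequencies, it is at least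
   a polynomial fraction of [peak phi ^+ n], and it is constant along every line
   orthogonal to all integer vectors orthogonal to [e]. *)
Lemma peak_split (e phi : 'rV[R]_d) (n : nat) :
  exists G : torus R d -> R[i], exists A : torus R d -> R,
  [/\ trig [set t | dotz t e < 0] G,
     forall u, complex.Re (G u) = peak phi u ^+ n - A u,
     forall u, peak phi u ^+ n <= n.+1%:R ^+ d * A u &
     forall (v : 'rV[R]_d), (forall t, dotz t e = 0 -> dotz t v = 0) ->
       forall th s, A (tor (th + s *: v)) = A (tor th)].
Proof.
(* By the binomial theorem in each coordinate, [peak phi ^+ n] is the squared modulus of a sum of
   monomials [z u k] with [k] in the box [{0, ..., n}^d]; the size of the box gives the factor
   [n.+1 ^ d]. *)
pose I := {ffun 'I_d -> 'I_n.+1}.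
pose t (k : I) : 'rV[int]_d := \row_j (k j : nat)%:Z.
pose c (k : I) : R[i] := \prod_j (2^-1 ^+ n * cis (- phi 0 j) ^+ k j *+ 'C(n, k j)).
pose z u (k : I) := c k * torus_exp u (t k).
pose tau (k : I) := dotz (t k) e.
have zz u k l : z u k * (z u l)^*%C = (c k * (c l)^*%C) * torus_exp u (t k - t l).
  by rewrite /z conjcM conj_torus_exp torus_expD mulrACA.
have sumz u : modulus (\sum_k z u k) ^+ 2 = peak phi u ^+ n.
  have -> : \sum_k z u k = \prod_j ((1 + cis (- phi 0 j) * set_val u 0 j) / 2) ^+ n.
    have -> : \prod_j ((1 + cis (- phi 0 j) * set_val u 0 j) / 2) ^+ n =
      \prod_(j < d) \sum_(i < n.+1)
        2^-1 ^+ n * cis (- phi 0 j) ^+ i *+ 'C(n, i) * (set_val u 0 j) ^ (i : nat)%:Z.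
      apply: eq_bigr => j _; rewrite exprMn exprDn mulr_suml.
      apply: eq_bigr => i _.
      by rewrite expr1n mul1r exprMn -exprnP !mulrnAl mulrC mulrA.
    rewrite bigA_distr_bigA; apply: eq_bigr => k _.
    by rewrite /z /c /torus_exp -big_split; apply: eq_bigr => j _ /=; rewrite mxE.
  rewrite /peak -prodrXl (big_morph _ (@ComplexField.Normc.normcM R) (@ComplexField.Normc.normc1 R)) -prodrXl.
  by apply: eq_bigr => j _; rewrite modulusX -!exprM mulnC.
exists (fun u => analytic_part tau (z u)), (fun u => resonant_part tau (z u)).
split.
- apply: trigZ; apply: trig_sum => k _; apply: trig_sum => l kl.
  apply: (@eq_trig _ _ _ (fun u => (c k * (c l)^*%C) * torus_exp u (t k - t l))).
    by move=> u; rewrite zz.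
  by apply: trig1; rewrite /= dotzDl dotzNl subr_lt0.
- by move=> u; rewrite Re_analytic_part sumz.
- move=> u; rewrite -sumz (le_trans (resonant_part_ge tau _))//.
  by rewrite card_ffun !card_ord natrX.
(* Resonant frequencies differ by an integer vector orthogonal to [e], hence to [v]. *)
- move=> v ev th s; apply: eq_bigr => k _; apply: eq_bigr => l /eqP kl.
  rewrite !zz !torus_exp_tor dotzDr dotzZr [dotz _ v]ev ?mulr0 ?addr0//.
  by rewrite dotzDl dotzNl -/(tau k) kl subrr.
Qed.

(** The half-angle formula [cos (x / 2) ^ 2 = (1 + cos x) / 2]. *)
Lemma modulus_half (w : R[i]) : modulus w = 1 ->
  modulus ((1 + w) / 2) ^+ 2 = (1 + complex.Re w) / 2.
Proof.
move=> w1; have := sqr_modulus w; rewrite w1 expr1n => E.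
have -> : (1 + w) / 2 = ((1 + complex.Re w) / 2) +i* (complex.Im w / 2).
  rewrite (_ : 2 = (2 : R)%:C); last by rewrite rmorphD rmorph1.
  by case: w {w1 E} => a b; rewrite -fmorphV; apply/eqP; rewrite eq_complex /= !mulr0 subr0 !add0r !eqxx.
rewrite sqr_modulus /=.
move: E; case: w {w1} => a b /= E; rewrite !exprMn.
have -> : b ^+ 2 = 1 - a ^+ 2 by rewrite E; ring.
by field.
Qed.

Lemma modulus_shift phi u j : modulus (cis (- phi 0 j) * set_val u 0 j) = 1.
Proof.
by rewrite ComplexField.Normc.normcM modulus_cis mul1r; have [th <- _] := tor_surj u;
  rewrite torE modulus_cis.
Qed.

Lemma peak_ge0 phi u : 0 <= peak phi u.
Proof. by apply: prodr_ge0 => j _; exact: sqr_ge0. Qed.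

Lemma peak_le1 phi u : peak phi u <= 1.
Proof.
apply: prodr_ile1 => j _; rewrite sqr_ge0/= modulus_half ?modulus_shift//.
have := Re_le_modulus (cis (- phi 0 j) * set_val u 0 j).
rewrite modulus_shift; lra.
Qed.

Lemma peak_tor phi : peak phi (tor phi) = 1.
Proof.
apply: big1 => j _; rewrite torE -cisD addNr cis0.
by rewrite modulus_half ?ComplexField.Normc.normc1// divff// -[1 + 1]/(2%:R).
Qed.

(** Factors in [[0, 1]] with product 1 all equal 1, and a number of modulus 1 and real part 1 is
    1. *)
Lemma peak_eq1 phi u : peak phi u = 1 -> u = tor phi.
Proof.
move=> b1; apply/val_inj/rowP => j; rewrite torE.
have F i : 0 <= modulus ((1 + cis (- phi 0 i) * set_val u 0 i) / 2) ^+ 2 <= 1.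
  rewrite sqr_ge0 /= modulus_half ?modulus_shift//.
  have := Re_le_modulus (cis (- phi 0 i) * set_val u 0 i).
  rewrite modulus_shift; lra.
have : modulus ((1 + cis (- phi 0 j) * set_val u 0 j) / 2) ^+ 2 = 1.
  move: b1; rewrite /peak (bigD1 j)//=.
  set a := (X in X * _ = 1); set b := \prod_(i | _) _ => ab.
  have b0 : b <= 1 by apply: prodr_ile1 => i _; exact: F.
  have /andP[a0 a1] := F j.
  by apply/le_anti; rewrite a1 -{1}ab ler_piMr.
have m1 := modulus_shift phi u j.
rewrite modulus_half// => H.
have Re1 : complex.Re (cis (- phi 0 j) * set_val u 0 j) = 1 by lra.
have := sqr_modulus (cis (- phi 0 j) * set_val u 0 j).
rewrite m1 Re1 => E.
have Im0 : complex.Im (cis (- phi 0 j) * set_val u 0 j) = 0.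
  by apply/eqP; rewrite -sqrf_eq0; lra.
have : cis (- phi 0 j) * set_val u 0 j = 1.
  by move: Re1 Im0; case: (cis _ * _) => a b /= -> ->.
by rewrite cisN => /(congr1 (fun w => cis (phi 0 j) * w)); rewrite mulVKf ?cis_neq0// mulr1.
Qed.

End peak.

(** * Continuity of complex functions and compactness of the torus *)

Section complex_continuity.
Variable R : realType.

(** Balls have complex radii here; this lemma and the next trade them for real ones, a positive
    complex number being real. *)
Lemma near_modulus (z : R[i]) (e : R) : 0 < e ->
  \forall w \near z, modulus (z - w) < e.
Proof.
move=> e0; apply/nbhs_ballP; exists (e%:C); first by rewrite /= ltcR.
by move=> w; rewrite -ball_normE /= ltcR.
Qed.

Lemma nbhs_modulus (z : R[i]) (A : set R[i]) : nbhs z A ->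
  exists2 e : R, 0 < e & forall w, modulus (z - w) < e -> A w.
Proof.
move=> /nbhs_ballP[e /= e0 eA].
have eR := RRe_real (gtr0_real e0).
exists (complex.Re e); first by rewrite -ltcR eR.
move=> w zw; apply: eA; rewrite -ball_normE /= -eR.
by rewrite -[`|_|]/((modulus (z - w))%:C) ltcR.
Qed.

Lemma continuous_Re : continuous (@complex.Re R : R[i] -> R).
Proof.
move=> z; apply/(@cvgrPdist_lt R R _ (nbhs z) (nbhs_filter z)) => e e0.
apply: (@filterS _ _ (nbhs_filter z) _ _ _ (near_modulus z e0)) => w zw.
by rewrite -raddfB; apply: le_lt_trans zw; exact: normRe_le_modulus.
Qed.

Lemma continuous_Im : continuous (@complex.Im R : R[i] -> R).
Proof.
move=> z; apply/(@cvgrPdist_lt R R _ (nbhs z) (nbhs_filter z)) => e e0.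
apply: (@filterS _ _ (nbhs_filter z) _ _ _ (near_modulus z e0)) => w zw.
by rewrite -raddfB; apply: le_lt_trans zw; exact: Im_le_modulus.
Qed.

Lemma continuous_Complex (X : topologicalType) (f g : X -> R) :
  continuous f -> continuous g -> continuous (fun x => f x +i* g x : R[i]).
Proof.
move=> cf cg x A /nbhs_modulus[e e0 eA].
have e20 : 0 < e / 2 by rewrite divr_gt0.
have /cvgrPdist_lt/(_ _ e20) Hf := cf x.
have /cvgrPdist_lt/(_ _ e20) Hg := cg x.
rewrite nbhs_simpl /=; near=> y; apply: eA.
apply: (le_lt_trans (modulus_le _)) => /=.
rewrite [e]splitr ltrD//.
  by near: y.
by near: y.
Unshelve. all: by end_near. Qed.

Lemma continuous_cis : continuous (@cis R).
Proof. apply: continuous_Complex; [exact: continuous_cos|exact: continuous_sin]. Qed.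

End complex_continuity.

Section torus_topology.
Variables (R : realType) (d : nat).

Lemma continuous_torus_coord j : continuous (fun u : torus R d => set_val u 0 j).
Proof.
suff H (u : torus R d) : {for u, continuous (fun u : torus R d => set_val u 0 j)} by exact: H.
have c1 := @initial_continuous (torus R d) 'rV[R[i]]_d set_val u.
exact: (continuous_comp c1 (@coord_continuous R[i] 1 d 0 j (set_val u))).
Qed.

Lemma continuous_to_torus (X : topologicalType) (f : X -> torus R d) :
  (forall j, continuous (fun x => set_val (f x) 0 j)) -> continuous f.
Proof.
move=> cf; apply: (@continuous_comp_initial _ X 'rV[R[i]]_d set_val f).
move=> x A [P Px PA]; rewrite nbhs_simpl /=.
have : \forall y \near x, forall ij : 'I_1 * 'I_d, P ij.1 ij.2 (set_val (f y) ij.1 ij.2).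
  apply: filter_forall => -[i j] /=; rewrite (ord1 i).
  by apply: (cf j x); have := Px 0 j.
by apply: filterS => y Py; apply: PA => i j; exact: (Py (i, j)).
Qed.

Lemma continuous_tor : continuous (@tor R d).
Proof.
apply: continuous_to_torus => j.
have -> : (fun x : 'rV[R]_d => set_val (tor x) 0 j) = @cis R \o (fun x => x 0 j).
  by apply/funext => x; rewrite torE.
move=> th; apply: continuous_comp; first exact: coord_continuous.
exact: continuous_cis.
Qed.

Lemma compact_torus : compact [set: torus R d].
Proof.
pose B := [set v : 'rV[R]_d | forall i, `[- pi, pi]%classic (v ord0 i)].
have -> : [set: torus R d] = @tor R d @` B.
  apply/seteqP; split=> // u _; have [th <- thP] := tor_surj u.
  by exists th => // i /=; rewrite in_itv /=; exact: thP.
apply: continuous_compact; last first.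
  by apply: (@rV_compact R d (fun=> `[- pi, pi]%classic)) => i; exact: segment_compact.
exact/continuous_subspaceT/continuous_tor.
Qed.

Lemma closed_compact_torus (K : set (torus R d)) : closed K -> compact K.
Proof. by move=> cK; apply: subclosed_compact cK compact_torus _. Qed.

Lemma continuous_peak phi : continuous (@peak R d phi).
Proof.
have -> : @peak R d phi = fun u => \prod_j ((1 + (cos (phi 0 j) * complex.Re (set_val u 0 j)
    + sin (phi 0 j) * complex.Im (set_val u 0 j))) / 2).
  apply/funext => u; apply: eq_bigr => j _.
  rewrite modulus_half ?modulus_shift//; congr ((1 + _) / _).
  by rewrite /cis cosN sinN; case: (set_val u 0 j) => a b /=; ring.
apply: (@continuous_big R 'I_d *%R 1 xpredT) => [|j _ u]; first exact: mul_continuous.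
have cj := @continuous_torus_coord.
pose re (x : torus R d) : R := complex.Re (set_val x 0 j).
pose im (x : torus R d) : R := complex.Im (set_val x 0 j).
have cre : {for u, continuous re} by exact: continuous_comp (cj _ _) (@continuous_Re R _).
have cim : {for u, continuous im} by exact: continuous_comp (cj _ _) (@continuous_Im R _).
have cc (c : R) : {for u, continuous (fun=> c)} by exact: cst_continuous.
exact: (continuousM (continuousD (cc 1) (continuousD (continuousM (cc _) cre)
  (continuousM (cc _) cim))) (cc _)).
Qed.

End torus_topology.

(** * Exponential decay against polynomial growth *)

Section growth.
Variable R : realType.

(** Each of the [n.+1] terms of [1 + q + ... + q^n] is at least [q^n], and this sum times [1 - q] is
    [1 - q^n.+1]. *)
Lemma succ_mul_expr_le (q : R) n : 0 <= q < 1 -> n.+1%:R * q ^+ n * (1 - q) <= 1.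
Proof.
move=> /andP[q0 q1].
suff : n.+1%:R * q ^+ n * (1 - q) <= 1 - q ^+ n.+1.
  by move=> /le_trans; apply; rewrite lerBlDr lerDl exprn_ge0.
elim: n => [|n IHn]; first by rewrite expr0 expr1; lra.
rewrite [n.+2%:R]mulrS.
have -> : (1 + n.+1%:R) * q ^+ n.+1 * (1 - q) =
  q * (n.+1%:R * q ^+ n * (1 - q)) + q ^+ n.+1 * (1 - q) by rewrite [q ^+ n.+1]exprS; ring.
have := ler_wpM2l q0 IHn.
have p0 : 0 <= q ^+ n.+1 <= 1 by rewrite exprn_ge0//= exprn_ile1// ltW.
rewrite [q ^+ n.+2]exprS; nra.
Qed.

(** Each factor [n.+1] is absorbed by raising the ratio from [s] to [t = (1 + s) / 2], since
    [n.+1 * (s / t)^n] is bounded. *)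
Lemma poly_mul_expr_le (d : nat) (r : R) : 0 <= r < 1 -> exists C s : R,
  [/\ 0 <= C, 0 <= s < 1 & forall n, n.+1%:R ^+ d * r ^+ n <= C * s ^+ n].
Proof.
elim: d r => [|d IHd] r r01.
  by exists 1, r; split => // n; rewrite expr0.
have [C [s [C0 /andP[s0 s1] H]]] := IHd r r01.
pose t := (1 + s) / 2; pose q := s / t.
have t0 : 0 < t by rewrite /t; lra.
have q01 : 0 <= q < 1.
  by rewrite divr_ge0 ?(ltW t0)//= ltr_pdivrMr// mul1r /t; lra.
exists (C / (1 - q)), t; split.
- by rewrite divr_ge0// subr_ge0; case/andP: q01 => _ /ltW.
- by rewrite (ltW t0) /t; lra.
move=> n; rewrite exprS -mulrA.
apply: (@le_trans _ _ (n.+1%:R * (C * s ^+ n))); first by rewrite ler_wpM2l.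
have -> : s = q * t by rewrite /q divfK// gt_eqF.
have q1 : 0 < 1 - q by rewrite subr_gt0; case/andP: q01.
rewrite exprMn mulrCA -mulrA ler_wpM2l// mulrA ler_wpM2r ?exprn_ge0 ?(ltW t0)//.
by rewrite -[leRHS]mul1r ler_pdivlMr// succ_mul_expr_le.
Qed.

Lemma poly_mul_expr_lt (d : nat) (r eps : R) : 0 <= r < 1 -> 0 < eps ->
  exists n : nat, n.+1%:R ^+ d * r ^+ n <= eps.
Proof.
move=> r01 e0; have [C [s [C0 /andP[s0 s1] H]]] := poly_mul_expr_le d r01.
have : (fun n => C * s ^+ n) @ \oo --> C * 0.
  by apply: cvgMr; apply: cvg_expr; rewrite ger0_norm.
rewrite mulr0 => /cvgrPdist_le/(_ _ e0)[n _ /(_ n (leqnn n))].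
rewrite /= sub0r normrN => Hn; exists n.
by apply: le_trans (H n) _; apply: le_trans Hn; exact: ler_norm.
Qed.

End growth.

(** * Integer relations of a real direction *)

Section integral_normal.
Variables (R : realType) (d : nat).

(* Thus the closed line of direction [v] lies in the closure of the flow of
   direction [e], even when [e] is irrational. *)
Lemma integral_normal (e : 'rV[R]_d) : e != 0 -> exists2 v : 'rV[int]_d, v != 0 &
  forall t, dotz t e = 0 -> dotz t (map_mx intr v : 'rV[R]_d) = 0.
Proof.
move=> e0.
(* The rows of [M] are integer vectors orthogonal to [e]; an [M] of maximal rank spans all such
   vectors over the rationals. *)
pose Q (r : nat) := `[< exists m (M : 'M[rat]_(m, d)), \rank M = r /\
  forall i, exists2 t : 'rV[int]_d, dotz t e = 0 & row i M = map_mx intr t >].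
have Q0 : exists r, Q r.
  by exists 0%N; apply/asboolP; exists 0%N, 0; split => [|[]//]; rewrite mxrank0.
have Qd r : Q r -> (r <= d)%N.
  by move=> /asboolP[m [M [<- _]]]; exact: rank_leq_col.
have [r /asboolP[m [M [rM MS]]] rmax] := ex_maxnP Q0 Qd.
have Me : map_mx (ratr : rat -> R) M *m e^T = 0.
  apply/row_matrixP => i; rewrite row_mul -map_row row0.
  have [t te ->] := MS i.
  apply/rowP => j; rewrite !mxE -[RHS]te; apply: eq_bigr => k _.
  by rewrite !mxE ratr_int (ord1 j).
(* At full rank, orthogonality to all rows would force [e = 0]. *)
have rd : (\rank M < d)%N.
  rewrite -(mxrank_map (ratr : {rmorphism rat -> R})) ltn_neqAle rank_leq_col andbT.
  apply/negP => /eqP rk.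
  have : row_free (map_mx (ratr : rat -> R) M)^T by rewrite /row_free mxrank_tr rk.
  move=> rf; move/eqP: e0; apply; apply: (row_free_inj rf).
  by rewrite mul0mx -[LHS]trmxK trmx_mul trmxK Me trmx0.
have : kermx M^T != 0.
  by rewrite -mxrank_eq0 mxrank_ker mxrank_tr -lt0n subn_gt0.
move=> /rowV0Pn[w /sub_kermxP wM w0].
(* A relation outside the row space of [M] would increase the maximal rank; so the kernel vector [w]
   is orthogonal to every relation. *)
have wt (t : 'rV[int]_d) : dotz t e = 0 -> map_mx intr t *m w^T = 0.
  move=> te.
  have : (map_mx intr t <= M)%MS.
    apply/negPn/negP => tM.
    have /rmax : Q (\rank (col_mx M (map_mx intr t))).
      apply/asboolP; exists (m + 1)%N, (col_mx M (map_mx intr t)); split => // i.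
      rewrite -(splitK i); case: (fintype.split i) => j /=.
        by rewrite rowKu; exact: MS.
      by rewrite rowKd; exists t => //; apply/rowP => k; rewrite !mxE (ord1 j).
    rewrite leqNgt -rM => /negP; apply.
    rewrite ltn_neqAle mxrankS ?andbT; last by rewrite -addsmxE addsmxSl.
    apply/negP => /eqP E; move/negP: tM; apply.
    apply: (@submx_trans _ _ _ _ _ _ (col_mx M (map_mx intr t))).
      by rewrite -addsmxE addsmxSr.
    have sub : (M <= col_mx M (map_mx intr t))%MS by rewrite -addsmxE addsmxSl.
    by have [_] := mxrank_leqif_sup sub; rewrite E eqxx => /esym.
  case/submxP => D ->; rewrite -mulmxA.
  have -> : M *m w^T = 0 by rewrite -[LHS]trmxK trmx_mul trmxK wM trmx0.
  by rewrite mulmx0.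
(* Clearing denominators: [v] is the integer vector [c w]. *)
pose c := \prod_i denq (w 0 i).
pose v : 'rV[int]_d := \row_j (numq (w 0 j) * \prod_(i | i != j) denq (w 0 i)).
have vE j : (v 0 j)%:~R = w 0 j * c%:~R.
  have -> : c = denq (w 0 j) * \prod_(i | i != j) denq (w 0 i) by rewrite /c (bigD1 j).
  by rewrite mxE !intrM numqE mulrA.
have c0 : c != 0 by apply/prodf_neq0 => i _; exact: denq_neq0.
exists v.
  apply: contra_neq w0 => v0; apply/rowP => j; rewrite [RHS]mxE.
  have := vE j; rewrite v0 mxE => /esym/eqP.
  by rewrite mulf_eq0 intr_eq0 (negbTE c0) orbF => /eqP.
move=> t /wt tw.
have : (\sum_j t 0 j * v 0 j)%:~R = 0 :> rat.
  rewrite rmorph_sum /=; transitivity ((map_mx intr t *m w^T) 0 0 * c%:~R).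
    rewrite mxE mulr_suml; apply: eq_bigr => j _.
    by rewrite intrM vE !mxE mulrA.
  by rewrite tw mxE mul0r.
move/eqP; rewrite intr_eq0 => /eqP tv.
transitivity ((\sum_j t 0 j * v 0 j)%:~R : R); last by rewrite tv.
by rewrite rmorph_sum; apply: eq_bigr => j _ /=; rewrite mxE intrM.
Qed.

End integral_normal.

(** * Half-space contractions *)

Section halfspace.
Variables (R : realType) (d : nat) (K : set (torus R d)).
Hypothesis Kclosed : closed K.
Hypothesis Kline : forall v : 'rV[int]_d, v != 0 -> forall th : 'rV[R]_d,
  exists s : R, ~ K (tor (th + s *: map_mx intr v)).

(** The peak attains its maximum on the compact set [K], and this maximum is not 1, the value taken
    only at [tor phi]. *)
Lemma peak_lt1_off phi : ~ K (tor phi) ->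
  exists2 rho, 0 <= rho < 1 & forall u, K u -> peak phi u <= rho.
Proof.
move=> phiK; have [->|/set0P K0] := eqVneq K set0.
  by exists 0 => //; rewrite lexx ltr01.
have cp : {within K, continuous (@peak R d phi)}.
  exact/continuous_subspaceT/continuous_peak.
have [c /set_mem Kc cmax] := compact_EVT_max K0 (closed_compact_torus Kclosed) cp.
exists (peak phi c); last by move=> u Ku; apply: cmax; exact: mem_set.
rewrite peak_ge0 lt_neqAle peak_le1 andbT.
by apply/negP => /eqP/peak_eq1 E; apply: phiK; rewrite -E.
Qed.

(* The peak is put at a point [tor phi] off [K] on the integral line through [u0]:
   on [K] its powers decay exponentially, while near [u0] their resonant part,
   being constant along that line, decays more slowly. *)
Lemma local_negative_part (e : 'rV[R]_d) (u0 : torus R d) : e != 0 ->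
  exists2 V : set (torus R d), open V /\ V u0 &
  forall eps : R, 0 < eps -> exists2 G, trig [set t | dotz t e < 0] G &
    (forall u, K u -> complex.Re (G u) <= eps) /\
    (forall u, K u -> V u -> complex.Re (G u) <= - 1).
Proof.
move=> e0; have [v v0 ev] := integral_normal e0.
have [th <- _] := tor_surj u0.
have [s sK] := Kline v0 th.
set phi := th + s *: _ in sK.
have [rho /andP[rho0 rho1] rhoK] := peak_lt1_off sK.
(* Strictly between [rho] and 1: the peak at [phi] is at most [rho] on [K], while [V] is where the
   peak at [th] exceeds [rho']; the ratio [(rho / rho')^n] then beats the factor [n.+1 ^ d]. *)
pose rho' := (1 + rho) / 2.
have rho'0 : 0 < rho' by rewrite /rho'; lra.
have rho'1 : rho' < 1 by rewrite /rho'; lra.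
have q01 : 0 <= rho / rho' < 1.
  rewrite divr_ge0 ?(ltW rho'0)//=.
  by rewrite ltr_pdivrMr// mul1r /rho'; lra.
pose sh : 'rV[R]_d := s *: map_mx intr v.
pose V := [set u : torus R d | rho' < peak th u].
exists V.
  split; last by rewrite /V /= peak_tor.
  rewrite (_ : V = @peak R d th @^-1` [set x | rho' < x]); last by [].
  by apply: open_comp; [move=> ? _; exact: continuous_peak|exact: open_gt].
(* Translation by [sh] carries the peak at [th] to the peak at [phi], and it leaves the resonant
   part unchanged. *)
have peak_shift u : exists psi', tor psi' = u /\ peak phi (tor (psi' + sh)) = peak th u.
  have [psi' psi'E _] := tor_surj u; exists psi'; split => //.
  rewrite -psi'E; apply: eq_bigr => j _; rewrite !torE -!cisD !mxE.
  by congr (modulus ((1 + cis _) / 2) ^+ 2); ring.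
move=> eps eps0.
pose eps' := Num.min eps 1 / 2.
have m0 : 0 < Num.min eps 1 by rewrite lt_min eps0 ltr01.
have e'0 : 0 < eps' by rewrite /eps' divr_gt0.
have [n Hn] := poly_mul_expr_lt d q01 e'0.
have [G [A [GE GA pA Ainv]]] := peak_split e phi n.
(* With this factor [c * A] is at least 2 on [V], while [c * peak phi ^+ n] is at most both [eps]
   and 1 on [K]; the difference is then at most -1 on [V] and at most [eps] elsewhere on [K]. *)
pose c : R := 2 * n.+1%:R ^+ d / rho' ^+ n.
have c0 : 0 < c by rewrite /c divr_gt0 ?mulr_gt0 ?exprn_gt0.
exists (fun u => c%:C * G u); first exact: trigZ.
have ReE u : complex.Re (c%:C * G u) = c * (peak phi u ^+ n - A u).
  by rewrite -GA; case: (G u) => a b /=; rewrite mul0r subr0.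
have small u : K u -> c * peak phi u ^+ n <= Num.min eps 1.
  move=> Ku; apply: (@le_trans _ _ (c * rho ^+ n)).
    by rewrite ler_wpM2l ?(ltW c0)// lerXn2r ?nnegrE ?peak_ge0// rhoK.
  have -> : c * rho ^+ n = 2 * (n.+1%:R ^+ d * (rho / rho') ^+ n).
    by rewrite /c (expr_div_n rho rho'); ring.
  by move: Hn; rewrite /eps'; lra.
have A0 u : 0 <= A u.
  have := le_trans (exprn_ge0 n (peak_ge0 phi u)) (pA u).
  by rewrite pmulr_rge0// exprn_gt0.
split=> u Ku; rewrite ReE.
  apply: (@le_trans _ _ (c * peak phi u ^+ n)).
    by rewrite ler_wpM2l ?(ltW c0)// lerBlDr lerDl.
  by apply: le_trans (small _ Ku) _; rewrite ge_min lexx.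
move=> Vu; have [psi' [psi'E psi'p]] := peak_shift u.
have AE : A u = A (tor (psi' + sh)) by rewrite -psi'E Ainv.
have Abig : 2 <= c * A u.
  have : rho' ^+ n <= n.+1%:R ^+ d * A u.
    rewrite AE; apply: le_trans (pA _); rewrite psi'p.
    by rewrite lerXn2r ?nnegrE ?peak_ge0 ?(ltW rho'0)// ltW.
  have -> : c * A u = 2 * ((n.+1%:R ^+ d * A u) / rho' ^+ n) by rewrite /c; ring.
  by move=> H; rewrite -[leLHS]mulr1 ler_wpM2l// ler_pdivlMr ?exprn_gt0// mul1r.
rewrite mulrBr; have := small _ Ku; rewrite le_min => /andP[_ s1].
lra.
Qed.

(** Finitely many sets [V u] cover [K]. At a point of [K] one of the corresponding functions
    contributes at most -1, and [eps] is so small that the others add at most [2^-1]. *)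
Lemma negative_part (e : 'rV[R]_d) : e != 0 ->
  exists2 G, trig [set t | dotz t e < 0] G &
    forall u, K u -> complex.Re (G u) <= - 2^-1.
Proof.
move=> e0.
pose V u := s2val (cid2 (local_negative_part u e0)).
have V1 u : open (V u) /\ V u u := s2valP (cid2 (local_negative_part u e0)).
have V2 u := s2valP' (cid2 (local_negative_part u e0)).
have := closed_compact_torus Kclosed; rewrite compact_cover.
move=> /(_ _ K V)[u _|u Ku|D DK KD]; first by case: (V1 u).
  by exists u => //; case: (V1 u).
pose M := (size (finmap.enum_fset D)).+1.
have M0 : 0 < M%:R :> R by rewrite ltr0n.
have eps0 : 0 < 2^-1 / M%:R :> R by rewrite divr_gt0.
pose G u := s2val (cid2 (V2 u _ eps0)).
have G1 u : trig [set t | dotz t e < 0] (G u) := s2valP (cid2 (V2 u _ eps0)).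
have G2 u := s2valP' (cid2 (V2 u _ eps0)).
exists (fun w => \sum_(u <- finmap.enum_fset D) G u w).
  by apply: trig_sum => u _; exact: G1.
move=> w Kw; rewrite Re_sum.
have [u0 /= u0D Vw] := KD _ Kw.
rewrite (big_rem u0)//=.
have [_ /(_ w Kw Vw)] := G2 u0; rewrite -/(G u0) => H1.
have H2 : \sum_(u <- rem u0 (finmap.enum_fset D)) complex.Re (G u w) <= 2^-1.
  apply: (@le_trans _ _ (\sum_(u <- rem u0 (finmap.enum_fset D)) (2^-1 / M%:R))).
    by apply: ler_sum => u _; have [+ _] := G2 u; exact.
  rewrite big_const_seq count_predT iter_addr_0 -[leLHS]mulr_natr -mulrA.
  rewrite ler_piMr// ler_pdivrMl// mulr1 ler_nat size_rem// /M.
  by rewrite (leq_trans (leq_pred _)).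
lra.
Qed.

Lemma trig_bounded E (f : torus R d -> R[i]) : trig E f ->
  exists2 B : R, 0 <= B & forall u, modulus (f u) <= B.
Proof.
move=> [s _ fE]; exists (\sum_(p <- s) modulus p.1).
  by apply: sumr_ge0 => p _; exact: modulus_ge0.
move=> u; rewrite fE; elim: s {fE} => [|p s IHs].
  by rewrite !big_nil ComplexField.Normc.normc0.
rewrite !big_cons (le_trans (modulusD _ _))// lerD//.
by rewrite ComplexField.Normc.normcM modulus_torus_exp mulr1.
Qed.

(** In [|1 + eps G|^2 = 1 + 2 eps Re G + eps^2 |G|^2] the linear term is at most [- eps] on [K], and
    [eps] is chosen so that the quadratic term is at most [eps / 2]. *)
Lemma halfspace_contraction (e : 'rV[R]_d) : e != 0 ->
  exists2 F, trig [set t | dotz t e < 0] F &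
  exists2 rho, 0 <= rho < 1 & forall u, K u -> modulus (1 + F u) ^+ 2 <= rho.
Proof.
move=> e0; have [G GE GK] := negative_part e0.
have [B B0 GB] := trig_bounded GE.
have B1 : 0 < 1 + B ^+ 2 by rewrite ltr_pwDl// sqr_ge0.
pose eps : R := (2 * (1 + B ^+ 2))^-1.
have eps0 : 0 < eps by rewrite invr_gt0 mulr_gt0.
have epsB : eps * (1 + B ^+ 2) = 2^-1.
  by rewrite /eps invfM mulrAC -mulrA mulfV ?mulr1// gt_eqF.
exists (fun u => eps%:C * G u); first exact: trigZ.
exists (1 - eps / 2).
  have : eps <= 2^-1 by rewrite -epsB ler_peMr ?(ltW eps0)// lerDl sqr_ge0.
  by lra.
move=> u Ku.
have -> : modulus (1 + eps%:C * G u) ^+ 2 =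
    1 + 2 * eps * complex.Re (G u) + eps ^+ 2 * modulus (G u) ^+ 2.
  by rewrite !sqr_modulus; case: (G u) => a b /=; ring.
have HB : modulus (G u) ^+ 2 <= B ^+ 2 by rewrite lerXn2r ?nnegrE ?modulus_ge0.
have H1 := GK u Ku.
have E2 : eps ^+ 2 * modulus (G u) ^+ 2 <= eps / 2.
  rewrite expr2 -mulrA ler_wpM2l ?(ltW eps0)// -epsB ler_wpM2l ?(ltW eps0)//.
  by apply: le_trans HB _; rewrite lerDr.
have E1 : 2 * eps * complex.Re (G u) <= - eps.
  have -> : - eps = 2 * eps * (- 2^-1) by field.
  by rewrite ler_wpM2l// mulr_ge0// ltW.
lra.
Qed.

End halfspace.

(** * Prediction polynomials, uniformly in the direction *)

Section prediction.
Variables (R : realType) (d : nat) (K : set (torus R d)).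
Hypothesis Kclosed : closed K.
Hypothesis Kline : forall v : 'rV[int]_d, v != 0 -> forall th : 'rV[R]_d,
  exists s : R, ~ K (tor (th + s *: map_mx intr v)).

Lemma continuous_dotz (t : 'rV[int]_d) : continuous (fun e : 'rV[R]_d => dotz t e).
Proof.
apply: (@continuous_big R 'I_d +%R 0 xpredT) => [|j _ e]; first exact: add_continuous.
have c1 : {for e, continuous (fun x : 'rV[R]_d => x 0 j)} by exact: coord_continuous.
have c2 : {for e, continuous (fun=> (t 0 j)%:~R : R)} by exact: cst_continuous.
exact: (continuousM c2 c1).
Qed.

(** Finitely many strict inequalities, continuous in the direction, persist near [e] with a common
    margin [eta]. *)
Lemma near_halfspace (T : eqType) (s : seq (T * 'rV[int]_d)) (e : 'rV[R]_d) :
  (forall p, p \in s -> dotz p.2 e < 0) ->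
  exists2 eta : R, 0 < eta & exists D : nat, \forall e' \near e,
    forall p, p \in s -> dotz p.2 e' <= - eta /\ forall j, (`|p.2 ord0 j| <= D)%N.
Proof.
elim: s => [_|p s IHs H].
  by exists 1 => //; exists 0%N; apply: filterE => e' q; rewrite in_nil.
have [q qs|eta eta0 [D sD]] := IHs; first by apply: H; rewrite inE qs orbT.
have pe : dotz p.2 e < 0 by apply: H; rewrite inE eqxx.
have eta2 : 0 < Num.min eta (- dotz p.2 e / 2).
  by rewrite lt_min eta0 divr_gt0// oppr_gt0.
exists (Num.min eta (- dotz p.2 e / 2)) => //.
exists (maxn D (\max_j `|p.2 ord0 j|%N)).
have p2 : 0 < - dotz p.2 e / 2 by rewrite divr_gt0// oppr_gt0.
have Hp : \forall e' \near e, `|dotz p.2 e - dotz p.2 e'| < - dotz p.2 e / 2.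
  have Hc : {for e, continuous (fun x : 'rV[R]_d => dotz p.2 x)} by exact: continuous_dotz.
  by move/(@cvgrPdist_lt R R _ (nbhs e) (nbhs_filter e)) : Hc; apply.
apply: (@filterS2 _ _ (nbhs_filter e) _ _ _ _ Hp sD) => e' H1 H2 q; rewrite inE => /orP[/eqP ->|/H2[{}H2 H3]].
  split.
    rewrite lerNr ge_min; apply/orP; right.
    by move: H1; rewrite ltr_norml => /andP[]; lra.
  by move=> j; rewrite leq_max; apply/orP; right; exact: (leq_bigmax j).
split; last by move=> j; rewrite leq_max H3.
by apply: le_trans H2 _; rewrite lerN2 ge_min lexx.
Qed.

(** A face of the unit sphere of the sup norm. Directions are normalised in this norm, so that the
    sphere is a finite union of products of compact sets. *)
Definition face (j : 'I_d) (b : bool) : set 'rV[R]_d :=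
  [set e | forall i, (if i == j then [set (-1) ^+ b] else `[-1, 1]%classic) (e ord0 i)].

Lemma compact_face j b : compact (face j b).
Proof.
apply: (@rV_compact R d (fun i => if i == j then [set (-1) ^+ b] else `[-1, 1]%classic)) => i.
by case: eqP => _; [exact: compact_set1|exact: segment_compact].
Qed.

(** One integer controls the margin, the size of the frequencies and the contraction; the property
    weakens as [n] grows, so finitely many instances can be merged. *)
Definition uniform_contraction (n : nat) (e : 'rV[R]_d) :=
  exists2 F, trig [set t | dotz t e <= - n.+1%:R^-1 /\ forall j, (`|t ord0 j| <= n)%N] F &
    forall u, K u -> modulus (1 + F u) ^+ 2 <= 1 - n.+1%:R^-1.

(** Compactness of the faces: the polynomial found at a direction [e] still serves at nearby
    directions, for all large [n]. *)
Lemma face_contraction : exists n, forall j b, face j b `<=` uniform_contraction n.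
Proof.
suff : \forall n \near \oo, forall x : 'I_d * bool, face x.1 x.2 `<=` uniform_contraction n.
  by case=> n _ /(_ n (leqnn n)) H; exists n => j b; exact: (H (j, b)).
apply: filter_forall => -[j b] /=.
have /compact_near_coveringP := @compact_face j b.
apply => e eF.
have e0 : e != 0.
  apply/eqP => e0; have := eF j; rewrite eqxx e0 mxE /= => /esym/eqP.
  by rewrite signr_eq0.
have [F [s sE FE] [rho /andP[rho0 rho1] FK]] := halfspace_contraction Kclosed Kline e0.
have [eta eta0 [D near_e]] := near_halfspace sE.
have m0 : 0 < Num.min eta (1 - rho) by rewrite lt_min eta0 subr_gt0.
near=> e' n => /=.
have n1 : n.+1%:R^-1 <= Num.min eta (1 - rho).
  by near: n; near_simpl; apply: filterS (near_infty_natSinv_lt (PosNum m0)) => k /ltW.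
have nD : (D <= n)%N by near: n; exists D.
move: n1; rewrite le_min => /andP[n1 n2].
have He' : forall p, p \in s -> dotz p.2 e' <= - eta /\ forall j, (`|p.2 ord0 j| <= D)%N.
  by near: e'.
exists F.
  exists s => // p /He'[H1 H2]; split.
    by apply: le_trans H1 _; rewrite lerN2.
  by move=> i; exact: leq_trans (H2 i) nD.
by move=> u Ku; apply: le_trans (FK u Ku) _; rewrite lerBrDr addrC -lerBrDr.
Unshelve. all: by end_near. Qed.

(** Sums of [i] frequencies of [F], with [1 <= i <= n], recorded through the bounds they satisfy. *)
Definition cone_layer (e : 'rV[R]_d) (eta : R) (D n : nat) : set 'rV[int]_d :=
  [set t | exists2 i : nat, (0 < i <= n)%N &
     dotz t e <= - (i%:R * eta) /\ forall j, (`|t ord0 j| <= i * D)%N].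

Lemma trig_pow e eta D n (F : torus R d -> R[i]) :
  trig [set t | dotz t e <= - eta /\ forall j, (`|t ord0 j| <= D)%N] F ->
  exists2 Q, trig (cone_layer e eta D n) Q & forall u, (1 + F u) ^+ n = 1 + Q u.
Proof.
move=> FE; elim: n => [|n [Q QE QF]].
  by exists (fun=> 0); [exact: trig0|move=> u; rewrite expr0 addr0].
exists (fun u => F u + Q u + F u * Q u); last first.
  by move=> u; rewrite exprS QF; ring.
apply: trigD; first apply: trigD.
- apply: trigS FE => t [t1 t2]; exists 1%N => //; split; first by rewrite mul1r.
  by move=> j; rewrite mul1n.
- by apply: trigS QE => t [i /andP[i0 i1] it]; exists i => //; rewrite i0 (leq_trans i1).
- apply: trigM FE QE => k l [k1 k2] [i /andP[i0 i1] [l1 l2]].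
  exists i.+1; first by rewrite ltnS.
  split; first by rewrite dotzDl mulrS mulrDl mul1r opprD lerD.
  have absD (a b : int) : (absz (a + b)%R <= absz a + absz b)%N by lia.
  by move=> j; rewrite mxE mulSn (leq_trans (absD _ _))// leq_add.
Qed.

(** Two sizes of a frequency: [supn] normalises directions and measures the decay, while the squared
    Euclidean length [norm2] orders the sites for prediction. *)
Definition supn (m : 'rV[int]_d) : nat := \max_j `|m ord0 j|%N.
Definition norm2 (m : 'rV[int]_d) : int := \sum_j (m ord0 j) ^+ 2.

Lemma face_normalized (m : 'rV[int]_d) : (0 < supn m)%N ->
  exists j b, face j b ((supn m)%:R^-1 *: map_mx intr m).
Proof.
move=> k0.
have d0 : (0 < #|'I_d|)%N.
  by move: k0; rewrite /supn; apply: contraTT; rewrite -eqn0Ngt => /eqP H; rewrite big1// => i; have := fintype0 i H.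
have [j jE] := @bigop.eq_bigmax 'I_d (fun j => `|m ord0 j|%N) d0.
exists j, (m ord0 j < 0) => i.
have kR : 0 < (supn m)%:R :> R by rewrite ltr0n.
have absE l : (`|m ord0 l|%N)%:R = `|(m ord0 l)%:~R| :> R.
  by rewrite -intr_norm -abszE natr_absz.
case: eqP => [->|_].
  rewrite /= !mxE {1}/supn jE.
  have -> : (m ord0 j)%:~R = (-1) ^+ (m ord0 j < 0)%R * `|m ord0 j|%N%:R :> R.
    by rewrite {1}[m ord0 j]intEsign intrM rmorph_sign.
  rewrite mulrC mulfK// pnatr_eq0 -lt0n -jE; exact: k0.
rewrite /= in_itv /= -ler_norml !mxE normrM normfV [`|_%:R|]ger0_norm//.
rewrite ler_pdivrMl// mulr1 -absE ler_nat.
exact: leq_bigmax.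
Qed.

Lemma norm2D (m l : 'rV[int]_d) :
  norm2 (m + l) = norm2 m + 2 * (\sum_j m ord0 j * l ord0 j) + norm2 l.
Proof.
rewrite /norm2 mulr_sumr -!big_split; apply: eq_bigr => j _ /=.
by rewrite mxE; ring.
Qed.

(** In [|m + l|^2 = |m|^2 + 2 m . l + |l|^2] the cone gives [m . l <= - i supn m / n0.+1], while
    [|l|^2 <= d (i n0)^2] is at most [i supn m / n0.+1] by the bound on [n >= i]. *)
Lemma norm2_cone_layer (m l : 'rV[int]_d) (n0 n : nat) : (0 < supn m)%N ->
  (n * (d * n0 ^ 2 * n0.+1) <= supn m)%N ->
  cone_layer ((supn m)%:R^-1 *: map_mx intr m) n0.+1%:R^-1 n0 n l ->
  norm2 (m + l) < norm2 m.
Proof.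
move=> k0 nk [i /andP[i0 iN] [l1 l2]].
have kR : 0 < (supn m)%:R :> R by rewrite ltr0n.
have eta0 : 0 < n0.+1%:R :> R by rewrite ltr0n.
pose s : int := \sum_j m ord0 j * l ord0 j.
have sE : dotz l ((supn m)%:R^-1 *: map_mx intr m) = (supn m)%:R^-1 * s%:~R :> R.
  rewrite /dotz /s rmorph_sum mulr_sumr; apply: eq_bigr => j _.
  by rewrite !mxE /= intrM mulrCA [_%:~R * _%:~R in RHS]mulrC.
have s1 : s%:~R * n0.+1%:R <= - (i%:R * (supn m)%:R) :> R.
  move: l1; rewrite sE mulrC ler_pdivrMr// => /(ler_wpM2r (ltW eta0)).
  by rewrite !mulNr mulrAC divfK// gt_eqF.
have s2 : s * n0.+1%:Z <= - (i%:Z * (supn m)%:Z).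
  by rewrite -(ler_int R) mulrNz !intrM; exact: s1.
have l3 : norm2 l <= (d * (i * n0) ^ 2)%N%:Z.
  rewrite /norm2 (@le_trans _ _ (\sum_(j < d) ((i * n0) ^ 2)%N%:Z))//; last first.
    by rewrite sumr_const card_ord PoszM -mulr_natl natz.
  apply: ler_sum => j _.
  have -> : (l ord0 j) ^+ 2 = (absz (l ord0 j) ^ 2)%N%:Z.
    by rewrite -mulnn PoszM abszE -expr2 real_normK ?num_real.
  by rewrite lez_nat leq_exp2r.
rewrite norm2D -/s -addrA gtrDl.
rewrite -(ltr_pM2r (isT : 0 < n0.+1%:Z)) mul0r mulrDl.
have nk' : (i * (d * n0 ^ 2 * n0.+1) <= supn m)%N.
  by apply: leq_trans nk; rewrite leq_mul2r iN orbT.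
have H : norm2 l * n0.+1%:Z <= i%:Z * (supn m)%:Z.
  apply: (@le_trans _ _ ((d * (i * n0) ^ 2)%N%:Z * n0.+1%:Z)).
    by rewrite ler_wpM2r.
  rewrite -!PoszM lez_nat expnMn (_ : d * _ * _ = i * (i * (d * n0 ^ 2 * n0.+1)))%N.
    by rewrite leq_mul2l nk' orbT.
  ring.
have ik : 0 < i%:Z * (supn m)%:Z by rewrite -PoszM ltz_nat muln_gt0 i0.
rewrite -mulrA; lia.
Qed.

Lemma prediction_polynomial : exists2 a : nat, (0 < a)%N &
  exists2 rho : R, 0 <= rho < 1 & forall m : 'rV[int]_d,
  exists2 Q, trig [set t | norm2 t < norm2 m] Q &
    forall u, K u -> modulus (torus_exp u m + Q u) ^+ 2 <= rho ^+ (supn m %/ a).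
Proof.
have [n0 Hn0] := face_contraction.
(* With this [a] the power [supn m %/ a] satisfies the bound required by [norm2_cone_layer]; the
   successor makes [a] positive. *)
pose a := (d * n0 ^ 2 * n0.+1).+1; exists a => //.
have eta0 : 0 < n0.+1%:R^-1 :> R by rewrite invr_gt0 ltr0n.
have eta1 : n0.+1%:R^-1 <= 1 :> R by rewrite invf_le1 ?ltr0n// ler1n.
have rho0 : 0 <= 1 - n0.+1%:R^-1 :> R by rewrite subr_ge0.
exists (1 - n0.+1%:R^-1); first by rewrite rho0 gtrDl oppr_lt0.
move=> m; have [k0|k0] := posnP (supn m).
  (* At the origin there is nothing to predict from, but the bound [rho ^+ 0 = 1] is trivial. *)
  exists (fun=> 0); first exact: trig0.
  by move=> u _; rewrite k0 div0n expr0 addr0 modulus_torus_exp expr1n.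
have [j [b mface]] := face_normalized k0.
have [F FE FK] := Hn0 _ _ _ mface.
have [Q QE QF] := trig_pow (supn m %/ a) FE.
exists (fun u => torus_exp u m * Q u); last first.
  move=> u Ku; rewrite -[X in X + _]mulr1 -mulrDr -QF.
  rewrite ComplexField.Normc.normcM modulus_torus_exp mul1r modulusX -exprM mulnC exprM.
  by rewrite lerXn2r ?nnegrE ?sqr_ge0// FK.
have mE : trig [set m] (fun u : torus R d => torus_exp u m).
  by have := @trig1 R d [set m] 1 m erefl; apply: eq_trig => u; rewrite mul1r.
apply: trigM mE QE => k l -> /norm2_cone_layer; apply => //.
by rewrite (leq_trans _ (leq_divM (supn m) a))// leq_mul2l leqnSn orbT.
Qed.

End prediction.

(** * Lines in simply connected sets *)

Section winding.
Variable R : realType.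

(** The retraction of the line onto [[0, 1]]: it turns maps continuous within [[0, 1]] into maps
    continuous everywhere. *)
Definition clamp (t : R) : R := Num.min 1 (Num.max 0 t).

Lemma clamp_itv t : clamp t \in `[0, 1].
Proof. by rewrite in_itv /= /clamp ge_min lexx le_min ler01 le_max lexx. Qed.

Lemma clamp_id t : t \in `[0, 1] -> clamp t = t.
Proof.
by rewrite in_itv /= /clamp => /andP[t0 t1]; rewrite (max_idPr t0) (min_idPr t1).
Qed.

Lemma continuous_clamp : continuous clamp.
Proof.
move=> t.
have c0 (c : R) : {for t, continuous (fun=> c)} by exact: cst_continuous.
have ci : {for t, continuous (fun t : R => t)} by exact: cvg_id.
exact: (continuous_min (c0 1) (continuous_max (c0 0) ci)).
Qed.

Lemma continuous_pair (X Y Z : topologicalType) (f : X -> Y) (g : X -> Z) :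
  continuous f -> continuous g -> continuous (fun x => (f x, g x)).
Proof.
move=> cf cg x A [[B C] [/= Bf Cg] BCA]; rewrite nbhs_simpl /=.
apply: (@filterS2 _ _ (nbhs_filter x) _ _ _ _ (cf x B Bf) (cg x C Cg)) => y By Cy.
exact: (BCA (f y, g y)).
Qed.

Lemma continuous_within_comp (X Y Z : topologicalType) (A : set Y)
    (f : Y -> Z) (g : X -> Y) :
  {within A, continuous f} -> continuous g -> (forall x, A (g x)) ->
  continuous (f \o g).
Proof.
move=> /subspace_continuousP cf cg gA x B Bfgx.
have := cf _ (gA x) B Bfgx; rewrite nbhs_simpl /= /within /= => H.
have := cg x _ H; rewrite nbhs_simpl /=; apply: filterS => y; apply; exact: gA.
Qed.

(* [k] is the winding number of [f] on [0, 1]. *)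
Definition lifts (k : R) (f : R -> R[i]) := exists phi : R -> R,
  [/\ continuous phi, forall t, f t = cis (phi t) & phi 1 - phi 0 = 2 * pi * k].

(** The quotient [w = g / f] stays within distance 1 of 1, so its real part is positive and
    [asin (Im w)] is a continuous argument of it. Added to the phase of [f], it does not change the
    increment, since [w] is a loop. *)
Lemma lifts_close k (f g : R -> R[i]) : lifts k f -> f 0 = f 1 -> continuous g ->
  (forall t, modulus (g t) = 1) -> g 0 = g 1 ->
  (forall t, modulus (f t - g t) < 1) -> lifts k g.
Proof.
move=> [phi [cphi fE phik]] f01 cg g1 g01 fg.
pose w t := g t * cis (- phi t).
have w1 t : modulus (w t) = 1 by rewrite ComplexField.Normc.normcM g1 modulus_cis mulr1.
have gE t : g t = cis (phi t) * w t by rewrite /w mulrCA -cisD subrr cis0 mulr1.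
have Re_w t : 0 < complex.Re (w t).
  have : modulus (1 - w t) < 1.
    have -> : 1 - w t = cis (- phi t) * (f t - g t).
      by rewrite mulrBr fE -cisD addNr cis0 mulrC.
    by rewrite ComplexField.Normc.normcM modulus_cis mul1r.
  by move=> /(le_lt_trans (Re_le_modulus _)); case: (w t) => a b /=; lra.
have reim t : complex.Re (w t) ^+ 2 = 1 - complex.Im (w t) ^+ 2.
  by have := sqr_modulus (w t); rewrite w1; lra.
have Im_w t : -1 < complex.Im (w t) < 1.
  rewrite -ltr_norml -(ltr_pXn2r (ltn0Sn 1)) ?nnegrE//.
  rewrite real_normK ?num_real// expr1n.
  by have := exprn_gt0 2 (Re_w t); rewrite reim; lra.
have cis_asin t : cis (asin (complex.Im (w t))) = w t.
  have /andP[y1 y2] := Im_w t.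
  have y12 : -1 <= complex.Im (w t) <= 1 by rewrite !ltW.
  rewrite /cis cos_asin// asinK// -reim sqrtr_sqr gtr0_norm//.
  by case: (w t).
have cw : continuous (fun t => complex.Im (w t)).
  have -> : (fun t => complex.Im (w t)) = (fun t =>
      complex.Im (g t) * cos (phi t) - complex.Re (g t) * sin (phi t)).
    apply/funext => t; rewrite /w /cis cosN sinN; case: (g t) => a b /=; ring.
  move=> t.
  have cre : {for t, continuous (fun t => complex.Re (g t))} by
    exact: continuous_comp (cg _) (@continuous_Re R _).
  have cim : {for t, continuous (fun t => complex.Im (g t))} by
    exact: continuous_comp (cg _) (@continuous_Im R _).
  have cc : {for t, continuous (fun t => cos (phi t))} by
    exact: continuous_comp (cphi _) (@continuous_cos R _).
  have cs : {for t, continuous (fun t => sin (phi t))} by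
    exact: continuous_comp (cphi _) (@continuous_sin R _).
  exact: continuousB (continuousM cim cc) (continuousM cre cs).
exists (fun t => phi t + asin (complex.Im (w t))); split.
- move=> t; apply: continuousD; first exact: cphi.
  apply: (@continuous_comp _ _ _ (fun t => complex.Im (w t)) asin); first exact: cw.
  exact: continuous_asin.
- by move=> t; rewrite gE cisD cis_asin.
- have -> : w 1 = w 0.
    rewrite /w g01; congr (_ * _); rewrite !cisN -!fE.
    by rewrite f01.
  by rewrite -phik; ring.
Qed.

(** A phase with increment of size at least [2 pi] takes, by the intermediate value theorem, a value
    at distance [pi] from its initial value, where [cis] has changed sign. *)
Lemma lifts_cst k c : 1 <= `|k| -> lifts k (fun=> c) -> False.
Proof.
move=> k0 [phi [cphi cE phik]].
have cw : {within `[0, 1], continuous phi} by exact: continuous_subspaceT.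
have cispi (x : R) : cis (x + pi) <> cis x.
  rewrite cisD {2}/cis cospi sinpi => /eqP; rewrite -subr_eq0 -[X in _ - X]mulr1 -mulrBr.
  rewrite mulf_eq0 (negbTE (cis_neq0 x)) /=.
  by rewrite eq_complex /= => /andP[/eqP + _]; lra.
have pi0 := pi_gt0 R.
have [k1|k1] : 1 <= k \/ k <= -1.
    by move: k0; rewrite ler_normr => /orP[]; [left|right]; lra.
  have [|t _ tE] := @IVT R phi 0 1 (phi 0 + pi) ler01 cw.
    by rewrite ge_min le_max; apply/andP; split; apply/orP; [left|right]; nra.
  by apply: (cispi (phi 0)); rewrite -tE -!cE.
have [|t _ tE] := @IVT R phi 0 1 (phi 0 - pi) ler01 cw.
  by rewrite ge_min le_max; apply/andP; split; apply/orP; [right|left]; nra.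
by apply: (cispi (phi 0 - pi)); rewrite subrK -tE -!cE.
Qed.

(** Neighbouring loops are uniformly close, so by [lifts_close] the set of parameters with winding
    number [k] is open and closed in the connected line. *)
Lemma lifts_homotopy k (h : R * R -> R[i]) : continuous h ->
  (forall a t, h (a, t) = h (a, clamp t)) ->
  (forall z, modulus (h z) = 1) -> (forall a, h (a, 0) = h (a, 1)) ->
  lifts k (fun t => h (0, t)) -> lifts k (fun t => h (1, t)).
Proof.
move=> ch hclamp h1 hloop l0.
have cha a : continuous (fun t => h (a, t)).
  move=> t; apply: (@continuous_comp _ _ _ (fun t => (a, t)) h); last exact: ch.
  apply: (@continuous_pair _ _ _ (fun=> a) (fun t => t)) t => s; last exact: cvg_id.
  exact: cst_continuous.
(* Compactness of [[0, 1]] gives uniformity over all real [t], as [h] depends on [t] only through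
   [clamp t]. *)
have close a : \forall a' \near a, forall t, modulus (h (a, t) - h (a', t)) < 1.
  have /compact_near_coveringP := @segment_compact R 0 1.
  move=> /(_ R (nbhs a) (fun a' t => modulus (h (a, t) - h (a', t)) < 1) _) H.
  have : \forall a' \near a, `[0, 1]%classic `<=` (fun t => modulus (h (a, t) - h (a', t)) < 1).
    apply: H => t _.
    have h2 : 0 < 2^-1 :> R by rewrite invr_gt0.
    have /= [[A B] /= [At Ba] AB] := ch (a, t) _ (near_modulus (h (a, t)) h2).
    exists (B, A) => //= -[t' a'] /= [Bt Aa].
    have H1 : modulus (h (a, t) - h (a, t')) < 2^-1.
      by apply: (AB (a, t')); split => //=; exact: nbhs_singleton.
    have H2 : modulus (h (a, t) - h (a', t')) < 2^-1 by exact: (AB (a', t')).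
    rewrite (_ : _ - _ = - (h (a, t) - h (a, t')) + (h (a, t) - h (a', t'))); last by ring.
    apply: le_lt_trans (modulusD _ _) _.
    by rewrite normcN [ltRHS]splitr !mul1r ltrD.
  by apply: filterS => a' Ha t; rewrite (hclamp a t) (hclamp a' t); exact: (Ha _ (clamp_itv t)).
pose A := [set a | lifts k (fun t => h (a, t))].
have stepA a a' : (forall t, modulus (h (a, t) - h (a', t)) < 1) -> A a -> A a'.
  by move=> aa' Aa; apply: (lifts_close Aa).
have oA : open A.
  rewrite openE => a Aa; apply: filterS (close a) => a' H.
  exact: stepA H Aa.
have cA : open (~` A).
  rewrite openE => a Aa; apply: filterS (close a) => a' H Aa'.
  apply: Aa; apply: (stepA a' a) => // t.
  by rewrite -normcN opprB.
have conn : connected [set: R] by apply/connected_intervalP => x y _ _ z _.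
have : A = setT.
  apply: conn.
  - by exists 0.
  - by exists A => //; rewrite setTI.
  - by exists A; [rewrite -openC|rewrite setTI].
by move=> AT; have : A 1 by rewrite AT.
Qed.

(** A closed line in [G] would be a loop whose coordinate [j] winds [v 0 j != 0] times, whereas
    contracting it inside [G] leads to a constant loop. *)
Lemma simply_connected_no_line (d : nat) (G : set (torus R d)) (v : 'rV[int]_d)
    (th : 'rV[R]_d) : simply_connected R G -> v != 0 ->
  exists s : R, ~ G (tor (th + s *: map_mx intr v)).
Proof.
move=> [_ Gloop] v0; apply: contrapT => /forallNP H.
have {}H s : G (tor (th + s *: map_mx intr v)) by apply: contrapT; exact: H.
have [j vj] : exists j, v 0 j != 0.
  apply: contrapT => /forallNP vE; move/eqP: v0; apply; apply/rowP => j.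
  by rewrite mxE; apply/eqP/negPn/negP; exact: vE.
pose gam (t : R) := tor (th + (2 * pi * t) *: map_mx intr v).
have gamE (t : R) i : set_val (gam t) 0 i = cis (th 0 i + 2 * pi * t * (v 0 i)%:~R).
  by rewrite torE !mxE.
have cline (a b : R) : continuous (fun t : R => a + 2 * pi * t * b).
  move=> t.
  have cc (c : R) : {for t, continuous (fun=> c)} by exact: cst_continuous.
  have ci : {for t, continuous (fun t : R => t)} by exact: cvg_id.
  exact: (continuousD (cc a) (continuousM (continuousM (cc (2 * pi)) ci) (cc b))).
have cgam : continuous gam.
  apply: continuous_to_torus => i.
  rewrite (_ : (fun t => _) = (fun t => cis (th 0 i + 2 * pi * t * (v 0 i)%:~R))).
    move=> t; apply: continuous_comp; first exact: cline.
    exact: continuous_cis.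
  by apply/funext => t; rewrite gamE.
have gam01 : gam 0 = gam 1.
  apply/val_inj/rowP => i; rewrite !gamE mulr0 mul0r addr0 mulr1.
  by rewrite cisD cis2piz mulr1.
have [|_ [t _ <-]|F [cF FG F0 Floop [c F1]]] := Gloop gam _ _ gam01.
- exact: continuous_subspaceT.
- exact: H.
(* Clamping both variables extends the homotopy from the square to the whole plane. *)
pose h (z : R * R) := set_val (F (clamp z.1, clamp z.2)) 0 j.
have cl0 : clamp 0 = 0 by rewrite clamp_id// in_itv /= lexx ler01.
have cl1 : clamp 1 = 1 by rewrite clamp_id// in_itv /= lexx ler01.
have ch : continuous h.
  have cH : continuous (F \o (fun z : R * R => (clamp z.1, clamp z.2))).
    apply: (continuous_within_comp cF).
      apply: continuous_pair => z; apply: continuous_comp; try exact: continuous_clamp.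
        move=> B Bz; exists (B, setT) => [|[x y] []//].
        by split => //; exact: filterT.
      move=> B Bz; exists (setT, B) => [|[x y] []//].
      by split => //; exact: filterT.
    by move=> z; split => /=; exact: clamp_itv.
  move=> z; apply: (@continuous_comp _ _ _ (F \o _) (fun u : torus R d => set_val u 0 j)).
    exact: cH.
  exact: continuous_torus_coord.
have /lifts_cst : lifts (v 0 j)%:~R (fun=> set_val c 0 j).
  have -> : (fun=> set_val c 0 j) = (fun t => h (1, t)).
    by apply/funext => t; rewrite /h /= cl1 F1// clamp_itv.
  apply: lifts_homotopy => //.
  - by move=> a t; rewrite /h /= (clamp_id (clamp_itv t)).
  - move=> z; rewrite /h; have [x <- _] := tor_surj (F (clamp z.1, clamp z.2)).
    by rewrite torE modulus_cis.
  - by move=> a; rewrite /h /= cl0 cl1 Floop// clamp_itv.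
  exists (fun t => th 0 j + 2 * pi * clamp t * (v 0 j)%:~R); split.
  - move=> t; apply: (@continuous_comp _ _ _ clamp (fun t => th 0 j + 2 * pi * t * (v 0 j)%:~R)).
      exact: continuous_clamp.
    exact: cline.
  - by move=> t; rewrite /h /= cl0 F0 ?clamp_itv// gamE.
  - by rewrite cl0 cl1; ring.
by apply; rewrite -intr_norm -[1]/(1%:~R) ler_int -gtz0_ge1 normr_gt0.
Qed.

End winding.

(** * Linear prediction *)

Section borel.
Variable R : realType.

Lemma continuous_borel_measurable (X : ptopologicalType) (f : X -> R) :
  continuous f -> measurable_fun [set: borel X] (f : borel X -> R).
Proof.
move=> /continuousP cf; apply: (measurability _ (measurable_realfun.RGenOpens.measurableE R)).
move=> _ [_ [a [b ->] <-]]; rewrite setTI.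
apply: sub_sigma_algebra; exact/cf/interval_open.
Qed.

Lemma open_borel (X : ptopologicalType) (A : set X) :
  open A -> measurable (A : set (borel X)).
Proof. by move=> oA; apply: sub_sigma_algebra. Qed.

Lemma closed_borel (X : ptopologicalType) (A : set X) :
  closed A -> measurable (A : set (borel X)).
Proof.
move=> cA; rewrite -[A]setCK; apply: measurableC; apply: open_borel.
by rewrite openC.
Qed.

End borel.

(** * The spectral measure is carried by its support *)

Section support.
Variables (R : realType) (d : nat).
Variable S : {finite_measure set (borel (torus R d)) -> \bar R}.

Lemma closed_support : closed (measure_support S).
Proof.
have -> : measure_support S =
    ~` \bigcup_(A in [set A : set (torus R d) | open A /\ ~ (0 < S A)%E]) A.
  apply/seteqP; split => [u uS [A [oA SA] Au]|u uA A oA Au]; first exact/SA/uS.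
  by apply: contrapT => SA; apply: uA; exists A.
apply: open_closedC; apply: bigcup_open => A [].
by [].
Qed.

Lemma peakC (phi th : 'rV[R]_d) : peak phi (tor th) = peak th (tor phi).
Proof.
apply: eq_bigr => j _; rewrite !torE -!cisD !modulus_half ?modulus_cis//=.
by rewrite (_ : - th 0 j + phi 0 j = - (- phi 0 j + th 0 j)) ?cosN// opprD opprK addrC.
Qed.

(** Finitely many open null sets cover a compact set that misses the support. *)
Lemma compact_negligible (C : set (torus R d)) : compact C ->
  C `&` measure_support S `<=` set0 -> S.-negligible (C : set (borel (torus R d))).
Proof.
move=> + CS; rewrite compact_cover => Ccov.
have H u : exists A : set (torus R d), open A /\ (C u -> A u /\ S A = 0%E).
  have [Cu|Cu] := pselect (C u); last by exists set0; split => //; exact: open0.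
  have uS : ~ measure_support S u by move=> uS; have := CS u; apply.
  move: uS => /existsNP[A /not_implyP[oA /not_implyP[Au SA]]].
  exists A; split => // _; split => //; apply/eqP.
  by move/negP: SA; rewrite -leNgt measure_le0.
pose A u := sval (cid (H u)).
have A1 u : open (A u) by have [] := svalP (cid (H u)).
have A2 u : C u -> A u u /\ S (A u) = 0%E by have [_] := svalP (cid (H u)).
have [//|u Cu|D DC CD] := Ccov (torus R d) C A.
  by exists u => //; case: (A2 u Cu).
apply: (@negligibleS _ (borel (torus R d)) R S _ _ CD).
rewrite /cover bigcup_fset big_seq; elim/big_ind : _ => [| |u uD].
- exact: negligible_set0.
- exact: (@negligibleU _ (borel (torus R d)) R S).
- have /set_mem Cu := DC _ uD.
  apply/(@negligibleP _ (borel (torus R d)) R S); last by case: (A2 u Cu).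
  exact: open_borel.
Qed.

(** Peaks play the role of a distance: the complement of the support is the countable union of the
    compact sets [Dn n], where all peaks centred in the support stay away from 1. *)
Lemma support_conegligible :
  S.-negligible (~` measure_support S : set (borel (torus R d))).
Proof.
pose Dn n := [set u : torus R d |
  forall th, measure_support S (tor th) -> peak th u <= 1 - n.+1%:R^-1].
have -> : ~` measure_support S = \bigcup_n Dn n.
  apply/seteqP; split => [u uS|u [n _ uD] uS]; last first.
    have [th thu _] := tor_surj u.
    have := uD th; rewrite thu => /(_ uS); rewrite -thu peak_tor.
    by rewrite leNgt gtrBl invr_gt0 ltr0n.
  have [th thu _] := tor_surj u; rewrite -thu in uS *.
  have [rho /andP[rho0 rho1] rhoS] := peak_lt1_off closed_support uS.
  have r0 : 0 < 1 - rho by rewrite subr_gt0.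
  have [n _ /(_ n (leqnn n)) Hn] := near_infty_natSinv_lt (PosNum r0).
  exists n => // th' /rhoS; rewrite peakC => /le_trans; apply.
  by rewrite lerBrDr addrC -lerBrDr ltW.
apply: (@negligible_bigcup _ (borel (torus R d)) R S) => n; apply: compact_negligible.
  apply: closed_compact_torus.
  have -> : Dn n = \bigcap_(th in [set th | measure_support S (tor th)])
      (@peak R d th @^-1` [set x | x <= 1 - n.+1%:R^-1]) by [].
  apply: closed_bigI => th _; apply: closed_comp; last exact: closed_le.
  by move=> u _; exact: continuous_peak.
move=> u [uD uS].
have [th thu _] := tor_surj u.
have := uD th; rewrite thu => /(_ uS); rewrite -thu peak_tor.
by rewrite leNgt gtrBl invr_gt0 ltr0n.
Qed.

End support.

(** * Continuity of trigonometric polynomials *)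

Section trig_continuity.
Variables (R : realType).

Definition ccontinuous (X : topologicalType) (f : X -> R[i]) :=
  continuous (fun x => complex.Re (f x)) /\ continuous (fun x => complex.Im (f x)).

Lemma ccontinuous_cst (X : topologicalType) (c : R[i]) : ccontinuous (fun _ : X => c).
Proof. by split => x; exact: cst_continuous. Qed.

Lemma ccontinuousD (X : topologicalType) (f g : X -> R[i]) :
  ccontinuous f -> ccontinuous g -> ccontinuous (fun x => f x + g x).
Proof.
move=> [f1 f2] [g1 g2]; split.
  rewrite (_ : (fun x => _) = (fun x => complex.Re (f x) + complex.Re (g x))).
    by move=> x; exact: (continuousD (f1 x) (g1 x)).
  by apply/funext => x; case: (f x) (g x) => a b [].
rewrite (_ : (fun x => _) = (fun x => complex.Im (f x) + complex.Im (g x))).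
  by move=> x; exact: (continuousD (f2 x) (g2 x)).
by apply/funext => x; case: (f x) (g x) => a b [].
Qed.

Lemma ccontinuousM (X : topologicalType) (f g : X -> R[i]) :
  ccontinuous f -> ccontinuous g -> ccontinuous (fun x => f x * g x).
Proof.
move=> [f1 f2] [g1 g2]; split.
  rewrite (_ : (fun x => _) = (fun x => complex.Re (f x) * complex.Re (g x)
      - complex.Im (f x) * complex.Im (g x))).
    by move=> x; exact: (continuousB (continuousM (f1 x) (g1 x)) (continuousM (f2 x) (g2 x))).
  by apply/funext => x; case: (f x) (g x) => a b [].
rewrite (_ : (fun x => _) = (fun x => complex.Re (f x) * complex.Im (g x)
    + complex.Im (f x) * complex.Re (g x))).
  by move=> x; exact: (continuousD (continuousM (f1 x) (g2 x)) (continuousM (f2 x) (g1 x))).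
by apply/funext => x; case: (f x) (g x) => a b [c e] /=; rewrite addrC.
Qed.

Lemma ccontinuousJ (X : topologicalType) (f : X -> R[i]) :
  ccontinuous f -> ccontinuous (fun x => (f x)^*%C).
Proof.
move=> [f1 f2]; split.
  rewrite (_ : (fun x => _) = (fun x => complex.Re (f x)))//.
  by apply/funext => x; case: (f x).
rewrite (_ : (fun x => _) = (fun x => - complex.Im (f x))).
  by move=> x; exact: (continuousN (f2 x)).
by apply/funext => x; case: (f x).
Qed.

Lemma ccontinuousX (X : topologicalType) (f : X -> R[i]) n :
  ccontinuous f -> ccontinuous (fun x => f x ^+ n).
Proof.
move=> cf; elim: n => [|n IHn]; first exact: ccontinuous_cst.
rewrite (_ : (fun x => _) = (fun x => f x * f x ^+ n)); first exact: ccontinuousM.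
by apply/funext => x; rewrite exprS.
Qed.

Lemma ccontinuous_prod (X : topologicalType) (J : Type) (s : seq J) (f : J -> X -> R[i]) :
  (forall j, ccontinuous (f j)) -> ccontinuous (fun x => \prod_(j <- s) f j x).
Proof.
move=> cf; elim: s => [|j s IHs].
  rewrite (_ : (fun x => _) = (fun x => 1)); first exact: ccontinuous_cst.
  by apply/funext => x; rewrite big_nil.
rewrite (_ : (fun x => _) = (fun x => f j x * \prod_(j <- s) f j x)); first exact: ccontinuousM.
by apply/funext => x; rewrite big_cons.
Qed.

Lemma continuous_sqr_modulus (X : topologicalType) (f : X -> R[i]) :
  ccontinuous f -> continuous (fun x => modulus (f x) ^+ 2).
Proof.
move=> [f1 f2].
rewrite (_ : (fun x => _) = (fun x => complex.Re (f x) * complex.Re (f x)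
    + complex.Im (f x) * complex.Im (f x))).
  by move=> x; exact: (continuousD (continuousM (f1 x) (f1 x)) (continuousM (f2 x) (f2 x))).
by apply/funext => x; rewrite sqr_modulus !expr2.
Qed.

Variable d : nat.

Lemma ccontinuous_torus_exp (k : 'rV[int]_d) : ccontinuous (fun u : torus R d => torus_exp u k).
Proof.
apply: ccontinuous_prod => j.
have cj : ccontinuous (fun u : torus R d => set_val u 0 j).
  have c := @continuous_torus_coord R d j.
  by split => u; [exact: continuous_comp (c u) (@continuous_Re R _)
                 |exact: continuous_comp (c u) (@continuous_Im R _)].
case: (k 0 j) => n; first exact: ccontinuousX.
(* On the circle the inverse is the conjugate, so negative powers are continuous as well. *)
rewrite (_ : (fun u => _) = (fun u : torus R d => (set_val u 0 j)^*%C ^+ n.+1)).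
  exact/ccontinuousX/ccontinuousJ.
apply/funext => u; have [th <- _] := tor_surj u.
by rewrite torE NegzE -exprz_inv -exprnP conj_cis cisN.
Qed.

Lemma trig_ccontinuous E (f : torus R d -> R[i]) : trig E f -> ccontinuous f.
Proof.
move=> [s _ fE].
rewrite (_ : f = fun u => \sum_(p <- s) p.1 * torus_exp u p.2); last exact/funext.
elim: s {f fE} => [|p s IHs].
  rewrite (_ : (fun u => _) = (fun u => 0)); first exact: ccontinuous_cst.
  by apply/funext => u; rewrite big_nil.
rewrite (_ : (fun u => _) = (fun u : torus R d => p.1 * torus_exp u p.2 +
    \sum_(q <- s) q.1 * torus_exp u q.2)).
  apply: ccontinuousD IHs; apply: ccontinuousM; first exact: ccontinuous_cst.
  exact: ccontinuous_torus_exp.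
by apply/funext => u; rewrite big_cons.
Qed.

End trig_continuity.

(** * From lists of monomials to finitely supported arrays *)

Section linear_forms.
Variables (R : realType) (d : nat).

(** Collects repeated frequencies, giving the array [f] in the defining identity of the spectral
    measure. *)
Definition coefs (s : seq (R[i] * 'rV[int]_d)) (k : 'rV[int]_d) : R[i] :=
  \sum_(p <- s | p.2 == k) p.1.

Lemma coefs_out s k : k \notin [seq p.2 | p <- s] -> coefs s k = 0.
Proof.
move=> ks; rewrite /coefs big_seq_cond big1// => p /andP[ps /eqP pk].
by move/negP: ks; case; rewrite -pk; apply: map_f.
Qed.

Lemma finite_coefs s : finite_set [set k | coefs s k != 0].
Proof.
apply: sub_finite_set (finite_seq [seq p.2 | p <- s]) => k /= /eqP ks.
by apply: contrapT => /negP /coefs_out.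
Qed.

Lemma sum_coefs s (h : 'rV[int]_d -> R[i]) :
  \sum_(k \in [set: 'rV[int]_d]) h k * coefs s k = \sum_(p <- s) p.1 * h p.2.
Proof.
rewrite (fsbigE (undup [seq p.2 | p <- s])) ?undup_uniq//; last first.
  by move=> k _; rewrite mem_undup => /coefs_out ->; rewrite mulr0.
rewrite (eq_bigl xpredT); last by move=> k; rewrite in_setT.
under eq_bigr do rewrite /coefs mulr_sumr.
rewrite (exchange_big_dep xpredT)//=; rewrite big_seq [RHS]big_seq.
apply: eq_bigr => p ps.
rewrite -big_filter (_ : [seq k <- _ | p.2 == k] = [:: p.2]) ?big_seq1 1?mulrC//.
have -> : [seq k <- undup [seq p.2 | p <- s] | p.2 == k] =
          [seq k <- undup [seq p.2 | p <- s] | k == p.2] by apply: eq_filter => k; rewrite eq_sym.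
by rewrite filter_pred1_uniq ?undup_uniq// mem_undup map_f.
Qed.

End linear_forms.

(** * Measurability of complex variables and the Markov inequality *)

Section random_variables.
Context d0 (T : measurableType d0) (R : realType) (P : probability T R).

Definition cmeasurable (Y : T -> R[i]) :=
  measurable_fun [set: T] (fun w => complex.Re (Y w)) /\
  measurable_fun [set: T] (fun w => complex.Im (Y w)).

Lemma cmeasurable_borel (Y : T -> R[i]) :
  measurable_fun [set: T] (Y : T -> borel R[i]) -> cmeasurable Y.
Proof.
move=> mY; split.
  exact: (measurableT_comp (continuous_borel_measurable (@continuous_Re R)) mY).
exact: (measurableT_comp (continuous_borel_measurable (@continuous_Im R)) mY).
Qed.

Lemma cmeasurable_cst c : cmeasurable (fun=> c).
Proof. by split; exact: measurable_cst. Qed.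

Lemma cmeasurableD (Y Z : T -> R[i]) :
  cmeasurable Y -> cmeasurable Z -> cmeasurable (fun w => Y w + Z w).
Proof.
move=> [Y1 Y2] [Z1 Z2]; split.
  rewrite (_ : (fun w => _) = (fun w => complex.Re (Y w) + complex.Re (Z w))).
    exact: measurable_funD.
  by apply/funext => w; case: (Y w) (Z w) => a b [].
rewrite (_ : (fun w => _) = (fun w => complex.Im (Y w) + complex.Im (Z w))).
  exact: measurable_funD.
by apply/funext => w; case: (Y w) (Z w) => a b [].
Qed.

Lemma cmeasurableZ c (Y : T -> R[i]) : cmeasurable Y -> cmeasurable (fun w => c * Y w).
Proof.
move=> [Y1 Y2]; split.
  rewrite (_ : (fun w => _) = (fun w => complex.Re c * complex.Re (Y w)
      - complex.Im c * complex.Im (Y w))).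
    by apply: measurable_funB; apply: measurable_funM => //; exact: measurable_cst.
  by apply/funext => w; case: c (Y w) => a b [].
rewrite (_ : (fun w => _) = (fun w => complex.Re c * complex.Im (Y w)
    + complex.Im c * complex.Re (Y w))).
  by apply: measurable_funD; apply: measurable_funM => //; exact: measurable_cst.
by apply/funext => w; case: c (Y w) => a b [e f] /=; rewrite addrC.
Qed.

Lemma cmeasurable_sum (J : Type) (s : seq J) (Y : J -> T -> R[i]) :
  (forall j, cmeasurable (Y j)) -> cmeasurable (fun w => \sum_(j <- s) Y j w).
Proof.
move=> mY; elim: s => [|j s IHs].
  rewrite (_ : (fun w => _) = (fun w => 0)); first exact: cmeasurable_cst.
  by apply/funext => w; rewrite big_nil.
rewrite (_ : (fun w => _) = (fun w => Y j w + \sum_(j <- s) Y j w)); first exact: cmeasurableD.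
by apply/funext => w; rewrite big_cons.
Qed.

Lemma measurable_sqr_modulus (Y : T -> R[i]) : cmeasurable Y ->
  measurable_fun [set: T] (fun w => modulus (Y w) ^+ 2).
Proof.
move=> [Y1 Y2].
rewrite (_ : (fun w => _) = (fun w => complex.Re (Y w) * complex.Re (Y w)
    + complex.Im (Y w) * complex.Im (Y w))).
  by apply: measurable_funD; apply: measurable_funM.
by apply/funext => w; rewrite sqr_modulus !expr2.
Qed.

Lemma measurable_modulus_ge (Y : T -> R[i]) (e : R) : cmeasurable Y -> 0 <= e ->
  measurable [set w | e <= modulus (Y w)].
Proof.
move=> mY e0.
rewrite (_ : [set w | _] = setT `&` (fun w => modulus (Y w) ^+ 2) @^-1` `[e ^+ 2, +oo[).
  by apply: measurable_sqr_modulus.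
rewrite setTI; apply/seteqP; split => w /=; rewrite in_itv /= andbT.
  by move=> H; rewrite lerXn2r ?nnegrE ?modulus_ge0.
by rewrite ler_pXn2r ?nnegrE ?modulus_ge0.
Qed.

Lemma markov_modulus (Y : T -> R[i]) (e : R) : cmeasurable Y -> 0 <= e ->
  ((e ^+ 2)%:E * P [set w | (e <= modulus (Y w))%R] <=
   'E_P[fun w => (modulus (Y w) ^+ 2)%R])%E.
Proof.
move=> mY e0; set A := [set w | _].
have mA : measurable A by exact: measurable_modulus_ge.
have mY2 : measurable_fun [set: T] (fun w => (modulus (Y w) ^+ 2)%:E).
  by apply/measurable_EFinP; exact: measurable_sqr_modulus.
rewrite unlock -integral_cst//.
apply: (@le_trans _ _ (\int[P]_(w in A) (modulus (Y w) ^+ 2)%:E)%E).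
  apply: ge0_le_integral => //.
  - by move=> w _; rewrite lee_fin sqr_ge0.
  - exact: measurable_funS mY2.
  - by move=> w; rewrite /A /= lee_fin => H; rewrite lerXn2r ?nnegrE ?modulus_ge0.
apply: ge0_subset_integral => //.
by move=> w _; rewrite lee_fin sqr_ge0.
Qed.

End random_variables.

(** * Prediction errors and the spectral measure *)

Section spectral.
Context d0 (T : measurableType d0) (R : realType) (P : probability T R).
Context (d : nat) (X : 'rV[int]_d -> T -> R[i]).
Variable S : {finite_measure set (borel (torus R d)) -> \bar R}.
Hypothesis X_field : random_field P X.
Hypothesis X_spectral : is_spectral_measure P X S.

Lemma cmeasurable_field m : cmeasurable (X m).
Proof. by apply: cmeasurable_borel; case: (X_field m). Qed.

Lemma fourier_coefs s (u : torus R d) :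
  fourier (coefs s) u = \sum_(p <- s) p.1 * torus_exp u p.2.
Proof. exact: sum_coefs. Qed.

Lemma measurable_fourier s : measurable_fun [set: borel (torus R d)]
  (fun u : borel (torus R d) => ((modulus (fourier (coefs s) u) ^+ 2)%:E)).
Proof.
apply/measurable_EFinP; apply: (@continuous_borel_measurable R (torus R d)).
apply: continuous_sqr_modulus; apply: (@trig_ccontinuous R d setT).
by exists s => // u; rewrite fourier_coefs.
Qed.

Lemma cvariance_coefs s : cvariance P (fun w => \sum_(p <- s) p.1 * X p.2 w) =
  (((2 * pi) ^- d)%:E * \int[S]_u ((modulus (fourier (coefs s) u) ^+ 2)%R)%:E)%E.
Proof.
rewrite -X_spectral; last exact: finite_coefs.
congr (cvariance P _); apply/funext => w.
exact/esym/(sum_coefs s (fun m => X m w)).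
Qed.

(** [S] is finite and carried by its support, so a bound there passes to the integral; [C] is
    [(2 pi)^-d] times the total mass. *)
Lemma spectral_bound : exists2 C : R, 0 <= C & forall s (eps : R), 0 <= eps ->
  (forall u, measure_support S u ->
     modulus (\sum_(p <- s) p.1 * torus_exp u p.2) ^+ 2 <= eps) ->
  (cvariance P (fun w => (\sum_(p <- s) p.1 * X p.2 w)%R) <= (C * eps)%:E)%E.
Proof.
pose c : R := (2 * pi) ^- d; pose v : R := fine (S [set: borel (torus R d)]).
have vE : S [set: borel (torus R d)] = v%:E.
  by rewrite /v fineK// fin_num_measure.
have c0 : 0 <= c by rewrite invr_ge0 exprn_ge0// mulr_ge0// pi_ge0.
have v0 : 0 <= v by rewrite -lee_fin -vE.
exists (c * v); first exact: mulr_ge0.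
move=> s eps eps0 H; rewrite cvariance_coefs -mulrA EFinM lee_wpmul2l ?lee_fin//.
apply: (@le_trans _ _ (\int[S]_(u in [set: borel (torus R d)]) eps%:E)%E); last first.
  by rewrite integral_cst// muleC EFinM -[X in (_ <= X * _)%E]vE.
apply: ae_ge0_le_integral => //.
- by move=> u _; rewrite lee_fin sqr_ge0.
- exact: measurable_fourier.
- apply: (negligibleS _ (support_conegligible S)) => u /= uS Su; apply: uS => _.
  by rewrite lee_fin fourier_coefs; exact: H.
Qed.

Hypothesis Kline : forall v : 'rV[int]_d, v != 0 -> forall th : 'rV[R]_d,
  exists s : R, ~ measure_support S (tor (th + s *: map_mx intr v)).

Definition past_predictor (F : 'rV[int]_d -> ('rV[int]_d -> R[i]) -> R[i]) :=
  forall m x x', (forall t, norm2 t < norm2 m -> x t = x' t) -> F m x = F m x'.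

(* The predictor absorbs the mean of the prediction error, so that the error is
   exactly the centred variable whose variance is given by the spectral measure. *)
Lemma prediction_error : exists F, past_predictor F /\
  (forall m, cmeasurable (fun w => X m w - F m (X ^~ w))) /\
  exists a : nat, (0 < a)%N /\ exists C rho : R, [/\ 0 <= C, 0 <= rho < 1 &
  forall m e, 0 <= e -> ((e ^+ 2)%:E * P [set w | (e <= modulus (X m w - F m (X ^~ w)))%R] <=
     (C * rho ^+ (supn m %/ a))%:E)%E].
Proof.
have [a a0 [rho rho01 H]] := prediction_polynomial (@closed_support R d S) Kline.
have [C C0 CP] := spectral_bound.
pose Q m := s2val (cid2 (H m)).
have Q1 m : trig [set t | norm2 t < norm2 m] (Q m) := s2valP (cid2 (H m)).
have Q2 m := s2valP' (cid2 (H m)).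
pose s m := s2val (cid2 (Q1 m)).
have s1 m : forall p, p \in s m -> norm2 p.2 < norm2 m := s2valP (cid2 (Q1 m)).
have s2 m : forall u, Q m u = _ := s2valP' (cid2 (Q1 m)).
pose y m := cmean P (fun w => \sum_(p <- (1, m) :: s m) p.1 * X p.2 w).
pose F m (x : 'rV[int]_d -> R[i]) := y m - \sum_(p <- s m) p.1 * x p.2.
have XF m w : X m w - F m (X ^~ w) =
    (\sum_(p <- (1, m) :: s m) p.1 * X p.2 w) - y m.
  by rewrite /F big_cons /= mul1r opprB addrA.
have mX m : cmeasurable (fun w => X m w - F m (X ^~ w)).
  rewrite (_ : (fun w => _) = (fun w => (\sum_(p <- (1, m) :: s m) p.1 * X p.2 w) + (- y m))).
    apply: cmeasurableD; last exact: cmeasurable_cst.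
    by apply: cmeasurable_sum => p; apply: cmeasurableZ; exact: cmeasurable_field.
  by apply/funext => w; rewrite XF.
exists F; split => [m x x' xx'|].
  rewrite /F; congr (_ - _); rewrite big_seq [RHS]big_seq; apply: eq_bigr => p ps.
  by rewrite xx'//; exact: s1.
split => //; exists a; split => //; exists C, rho; split => // m e e0.
apply: le_trans (markov_modulus P (mX m) e0) _.
have := CP ((1, m) :: s m) (rho ^+ (supn m %/ a)).
rewrite /cvariance -/(y m) => CPm.
rewrite (_ : (fun w => _) = (fun w => modulus (\sum_(p <- (1, m) :: s m) p.1 * X p.2 w - y m) ^+ 2)).
  apply: CPm; first by rewrite exprn_ge0//; case/andP: rho01.
  by move=> u /(Q2 m); rewrite -/(Q m) s2 big_cons /= mul1r.
by apply/funext => w; rewrite XF.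
Qed.

End spectral.

(** * Sites of a finite box *)

Section sites.
Variable d : nat.

(** Indexes the box [[-b, b]^d] by a finite type, so that its sites can be counted. *)
Definition site (b : nat) (k : {ffun 'I_d -> 'I_(2 * b).+1}) : 'rV[int]_d :=
  \row_j ((k j : nat)%:Z - b%:Z).

Lemma siteP b (m : 'rV[int]_d) : (supn m <= b)%N -> 
  exists k : {ffun 'I_d -> 'I_(2 * b).+1}, site k = m.
Proof.
move=> mb.
have H j : (absz (m ord0 j) <= b)%N.
  by apply: leq_trans mb; exact: (leq_bigmax j).
exists [ffun j => inord (absz (m ord0 j + b%:Z)%R)].
apply/rowP => j; rewrite mxE ffunE inordK; last by have := H j; lia.
rewrite (_ : m 0 j = m ord0 j)//; have := H j; lia.
Qed.

End sites.

(** * Union bounds and Borel-Cantelli *)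

Section union_bounds.
Context d0 (T : measurableType d0) (R : realType) (mu : {measure set T -> \bar R}).

Lemma measure_bigsetU_le (J : Type) (s : seq J) (A : J -> set T) (c : \bar R) :
  (forall j, measurable (A j)) -> (forall j, (mu (A j) <= c)%E) ->
  (mu (\big[setU/set0]_(j <- s) A j) <= (size s)%:R%:E * c)%E.
Proof.
move=> mA Ac; elim: s => [|j s IHs]; first by rewrite big_nil measure0 mul0e.
have mB : measurable (\big[setU/set0]_(j <- s) A j) by exact: bigsetU_measurable.
rewrite big_cons; apply: (le_trans (measureU2 mu (mA j) mB)).
by rewrite /= mulrS EFinD ge0_muleDl// mul1e; exact: leeD.
Qed.

Lemma geometric_sum_le (r : R) (n k : nat) : 0 <= r < 1 ->
  \sum_(n <= i < k) r ^+ i <= r ^+ n / (1 - r).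
Proof.
move=> /andP[r0 r1]; have r1' : 0 < 1 - r by rewrite subr_gt0.
have [nk|kn] := leqP n k; last first.
  by rewrite big_geq ?(ltnW kn)// divr_ge0 ?exprn_ge0// ltW.
suff -> : \sum_(n <= i < k) r ^+ i = (r ^+ n - r ^+ k) / (1 - r).
  by rewrite ler_pM2r ?invr_gt0// lerBlDr lerDl exprn_ge0.
elim: k nk => [|k IHk]; first by rewrite leqn0 => /eqP ->; rewrite big_geq// subrr mul0r.
rewrite leq_eqVlt => /orP[/eqP ->|nk]; first by rewrite big_geq// subrr mul0r.
by rewrite big_nat_recr//= IHk// exprS; field; rewrite gt_eqF.
Qed.

(** The limsup event lies in every tail union, of measure at most [C r^n / (1 - r)]. *)
Lemma geometric_limsup_negligible (B : (set T)^nat) (C r : R) :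
  0 <= C -> 0 <= r < 1 -> (forall n, measurable (B n)) ->
  (forall n, (mu (B n) <= (C * r ^+ n)%:E)%E) ->
  mu.-negligible [set w | forall n, exists2 l, (n <= l)%N & B l w].
Proof.
move=> C0 r01 mB BC; have /andP[r0 r1] := r01.
pose L := [set w | forall n, exists2 l, (n <= l)%N & B l w].
have mL : measurable L.
  have -> : L = \bigcap_n \bigcup_(l in [set l | (n <= l)%N]) B l.
    apply/seteqP; split => [w Lw n _|w Lw n]; first by have [l nl Bl] := Lw n; exists l.
    by have [l nl Bl] := Lw n I; exists l.
  by apply: bigcapT_measurable => n; apply: bigcup_measurable.
apply/negligibleP => //; apply/eqP; rewrite -measure_le0.
suff H n : (mu L <= (C * (r ^+ n / (1 - r)))%:E)%E.
  apply/lee_addgt0Pr => e e0; rewrite add0e.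
  have : (fun n => C / (1 - r) * r ^+ n) @ \oo --> C / (1 - r) * 0.
    by apply: cvgMr; apply: cvg_expr; rewrite ger0_norm.
  rewrite mulr0 => /cvgrPdist_le/(_ _ e0)[n _ /(_ n (leqnn n))].
  rewrite /= sub0r normrN => Hn.
  apply: le_trans (H n) _; rewrite lee_fin; apply: le_trans Hn.
  by rewrite mulrCA mulrC; exact: ler_norm.
have LB : L `<=` \bigcup_(n0 in ~` `I_n) B n0.
  by move=> w /(_ n)[l nl Bl]; exists l => //=; rewrite ltnNge; apply/negP; rewrite negbK.
apply: (le_trans (measure_sigma_subadditive_tail mu mB mL LB)).
apply: lime_le; first exact: is_cvg_nneseries.
apply: nearW => k.
apply: (@le_trans _ _ (\sum_(n <= i < k) (C * r ^+ i)%:E)%E); first exact: lee_sum.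
rewrite sumEFin lee_fin -mulr_sumr ler_wpM2l//.
exact: geometric_sum_le.
Qed.

End union_bounds.

(** * The field takes almost surely countably many values *)

Section countable_law.
Context d0 (T : measurableType d0) (R : realType) (P : probability T R).
Context (d : nat) (X : 'rV[int]_d -> T -> R[i]) (U : set R[i]).
Hypothesis U_discrete : uniformly_discrete U.
Hypothesis X_U : forall m w, U (X m w).

(** The factor 2 is there because two values within [e] of the same prediction are to be
    identified. *)
Lemma uniform_gap : exists2 e : R, 0 < e &
  forall z z', U z -> U z' -> modulus (z - z') < 2 * e -> z = z'.
Proof.
move: U_discrete; rewrite /uniformly_discrete; set I := ereal_inf _ => I0.
(* The infimum is [+oo] when [U] has at most one point; any gap then serves. *)
have [e e0 eI] : exists2 e : R, 0 < e & (e%:E <= I)%E.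
  move: I0; case: I => [r| |] // r0; first by exists r.
  by exists 1 => //; rewrite leey.
exists (e / 2); first by rewrite divr_gt0.
move=> z z' Uz Uz'; rewrite mulrC divfK// => H.
apply: contrapT => /eqP zz'.
have : (I <= (modulus (z - z'))%:E)%E by apply: ereal_inf_lbound; exists z, z'.
by move=> /(le_trans eI); rewrite lee_fin leNgt H.
Qed.

Variable F : 'rV[int]_d -> ('rV[int]_d -> R[i]) -> R[i].
Hypothesis F_past : past_predictor F.

Definition predicted_arrays (e : R) (b : nat) : set ('rV[int]_d -> R[i]) :=
  [set x | (forall m, U (x m)) /\
     forall m, (b <= supn m)%N -> modulus (x m - F m x) < e].

(** Outside the box of radius [b] the array is recovered from its predictions, so finitely many
    integers encode it. *)
Lemma countable_predicted_arrays (e : R) (b : nat) : 0 < e ->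
  (forall z z', U z -> U z' -> modulus (z - z') < 2 * e -> z = z') ->
  countable (predicted_arrays e b).
Proof.
move=> e0 Ue; apply/countable_injP.
(* Values in the box are read on a grid of mesh [e]: equal codes mean values less than [2 * e]
   apart, hence equal. *)
pose code (x : 'rV[int]_d -> R[i]) : {ffun {ffun 'I_d -> 'I_(2 * b).+1} -> int * int} :=
  [ffun k => (Num.floor (complex.Re (x (site k)) / e),
              Num.floor (complex.Im (x (site k)) / e))].
exists (fun x => choice.pickle (code x)).
move=> x x' /set_mem[Ux Fx] /set_mem[Ux' Fx'] /(pcan_inj choice.pickleK) cxx'.
have floor_close (a a' : R) : Num.floor (a / e) = Num.floor (a' / e) -> `|a - a'| < e.
  move=> E; have := floor_itv (a / e); have := floor_itv (a' / e); rewrite E intrD.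
  move: (Num.floor _)%:~R => n /andP[]; rewrite ler_pdivlMr// ltr_pdivrMr// mulrDl mul1r => h1 h2.
  rewrite ler_pdivlMr// ltr_pdivrMr// mulrDl mul1r => /andP[h3 h4].
  by rewrite ltr_norml; apply/andP; split; lra.
have small m : (supn m <= b)%N -> x m = x' m.
  move=> /siteP[k <-]; apply: Ue => //.
  have := congr1 (fun f : {ffun _ -> _} => f k) cxx'; rewrite !ffunE => -[/floor_close h1 /floor_close h2].
  apply: (le_lt_trans (modulus_le _)).
  move: h1 h2; case: (x _) (x' _) => a a' [c c'] /= h1 h2.
  by rewrite mulr_natl mulr2n ltrD.
(* Induction on [norm2]: outside the box, equal pasts give equal predictions, and both values are
   within [e] of them. *)
suff H n m : (absz (norm2 m) < n)%N -> x m = x' m.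
  by apply/funext => m; apply: (H (absz (norm2 m)).+1).
elim: n m => [//|n IHn] m mn.
have [mb|bm] := leqP (supn m) b; first exact: small.
have n0 (t : 'rV[int]_d) : 0 <= norm2 t by apply: sumr_ge0 => j _; exact: sqr_ge0.
have FE : F m x = F m x'.
  apply: F_past => t tm; apply: IHn; have := n0 t; have := n0 m; lia.
apply: Ue => //.
rewrite (_ : x m - x' m = (x m - F m x) + - (x' m - F m x')); last by rewrite FE; ring.
apply: (le_lt_trans (modulusD _ _)); rewrite normcN mulr_natl mulr2n.
by rewrite ltrD//; [apply: Fx|apply: Fx']; exact: ltnW.
Qed.

Hypothesis mF : forall m, cmeasurable (fun w => X m w - F m (X ^~ w)).
Variables (a : nat) (C rho : R).
Hypothesis a0 : (0 < a)%N.
Hypothesis C0 : 0 <= C.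
Hypothesis rho01 : 0 <= rho < 1.
Hypothesis FC : forall m e, 0 <= e ->
  ((e ^+ 2)%:E * P [set w | (e <= modulus (X m w - F m (X ^~ w)))%R] <=
     (C * rho ^+ (supn m %/ a))%:E)%E.

(** Borel-Cantelli over the shells [supn m %/ a = l]: a shell has polynomially many sites, each with
    an exponentially small probability of an error at least [e]. *)
Lemma countable_law_of_predictor :
  exists2 A : set ('rV[int]_d -> R[i]), countable A &
    P.-negligible [set w | ~ A (X ^~ w)].
Proof.
have [e e0 Ue] := uniform_gap.
exists (\bigcup_b predicted_arrays e b).
  by apply: bigcup_countable => // b _; exact: countable_predicted_arrays.
pose E m := [set w | e <= modulus (X m w - F m (X ^~ w))].
have mE m : measurable (E m) by apply: measurable_modulus_ge => //; exact: ltW.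
have PE m : (P (E m) <= (C / e ^+ 2 * rho ^+ (supn m %/ a))%:E)%E.
  rewrite mulrAC mulrC EFinM lee_pdivlMl ?exprn_gt0//.
  exact/FC/ltW.
(* The shell of index [l] lies in the box of radius [b l]. *)
pose b l := (a * l.+1)%N.
pose B l := \big[setU/set0]_(k <- enum {ffun 'I_d -> 'I_(2 * b l).+1})
  (if (supn (site k) %/ a == l)%N then E (site k) else set0).
have mB l : measurable (B l).
  by apply: bigsetU_measurable => k _; case: ifP.
have PB l : (P (B l) <= (((2 * b l).+1%:R ^+ d) * (C / e ^+ 2 * rho ^+ l))%:E)%E.
  have c0 : 0 <= C / e ^+ 2 * rho ^+ l.
    by rewrite mulr_ge0 ?divr_ge0 ?exprn_ge0 ?(ltW e0)//; case/andP: rho01.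
  have := @measure_bigsetU_le _ T R P _ (enum {ffun 'I_d -> 'I_(2 * b l).+1})
    (fun k => if (supn (site k) %/ a == l)%N then E (site k) else set0) _ _ _.
  move=> /(_ (C / e ^+ 2 * rho ^+ l)%:E); rewrite EFinM -cardE card_ffun !card_ord natrX; apply.
    by move=> k; case: ifP.
  move=> k; case: ifP => [/eqP kl|_]; first by have := PE (site k); rewrite kl.
  by rewrite measure0 lee_fin.
have [C' [s [C'0 s01 Hs]]] := poly_mul_expr_le d rho01.
have PB' l : (P (B l) <= ((2 * a).+1%:R ^+ d * (C / e ^+ 2) * C' * s ^+ l)%:E)%E.
  apply: le_trans (PB l) _; rewrite lee_fin.
  have q0 : 0 <= C / e ^+ 2 by rewrite divr_ge0 ?exprn_ge0 ?(ltW e0).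
  move: (C / e ^+ 2) q0 => q q0; rewrite mulrCA [_ * q]mulrC -!mulrA ler_wpM2l//.
  apply: (@le_trans _ _ ((2 * a).+1%:R ^+ d * (l.+1%:R ^+ d * rho ^+ l))); last first.
    by rewrite ler_wpM2l ?exprn_ge0//; exact: Hs.
  rewrite mulrA ler_wpM2r ?exprn_ge0//; first by case/andP: rho01.
  rewrite -exprMn lerXn2r ?nnegrE ?mulr_ge0// -natrM ler_nat /b.
  by rewrite mulSn mulnA; lia.
have CC : 0 <= (2 * a).+1%:R ^+ d * (C / e ^+ 2) * C'.
  by rewrite !mulr_ge0 ?invr_ge0 ?exprn_ge0 ?(ltW e0).
have := geometric_limsup_negligible CC s01 mB PB'.
apply: negligibleS => w /= wA n; apply: contrapT => nB; apply: wA.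
(* The sites with [supn m >= n * a] are those of the shells of index at least [n]. *)
exists (n * a)%N => //; split=> // m nm; rewrite ltNge; apply/negP => mE'.
apply: nB; exists (supn m %/ a)%N; first by rewrite leq_divRL.
have [k kE] : exists k : {ffun 'I_d -> 'I_(2 * b (supn m %/ a)%N).+1}, site k = m.
  by apply: siteP; rewrite /b mulnC; exact/ltnW/ltn_ceil.
rewrite /B -bigcup_seq; exists k; first by rewrite /= mem_enum.
by rewrite kE eqxx.
Qed.

End countable_law.

(** * Atoms and periods *)

Section array_measurability.
Variables (R : realType) (d : nat).

Lemma closed_complex1 (z : R[i]) : closed [set z].
Proof.
rewrite -openC openE => w wz; rewrite /interior.
have m0 : 0 < modulus (w - z).
  rewrite lt_neqAle modulus_ge0 andbT eq_sym; apply/eqP.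
  move=> /ComplexField.Normc.eq0_normc/eqP; rewrite subr_eq0 => /eqP wz'.
  exact: wz.
apply: (@filterS _ _ (nbhs_filter w) _ _ _ (near_modulus w m0)) => v.
by move=> + vz; rewrite vz ltxx.
Qed.

Lemma measurable_cylinder (m : 'rV[int]_d) (B : set (borel R[i])) : measurable B ->
  measurable ([set x | B (x m)] : set (array_space R d)).
Proof. by move=> mB; apply: sub_sigma_algebra; exists m; exists B. Qed.

Lemma measurable_coordinate (m : 'rV[int]_d) :
  measurable_fun [set: array_space R d] (fun x : array_space R d => x m : borel R[i]).
Proof. by move=> _ B mB; rewrite setTI; exact: measurable_cylinder. Qed.

Lemma cmeasurable_coordinate (m : 'rV[int]_d) :
  cmeasurable (fun x : array_space R d => x m).
Proof. apply: cmeasurable_borel; exact: measurable_coordinate. Qed.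

Lemma measurable_countable_forall d1 (T : measurableType d1) (I : countType) (A : I -> set T) :
  (forall i, measurable (A i)) -> measurable [set x | forall i, A i x].
Proof.
move=> mA.
have -> : [set x | forall i, A i x] =
    \bigcap_n (if choice.unpickle n is Some i then A i else setT).
  apply/seteqP; split => [x Ax n _|x Ax i]; first by case: choice.unpickle.
  by have := Ax (choice.pickle i) Logic.I; rewrite choice.pickleK.
by apply: bigcapT_measurable => n; case: choice.unpickle.
Qed.

Lemma measurable_array1 (x : array_space R d) : measurable [set x].
Proof.
have -> : [set x] = [set y : array_space R d | forall m, y m = x m].
  by apply/seteqP; split => [y -> //|y yx]; apply/funext.
apply: measurable_countable_forall => m.
apply: (@measurable_cylinder m [set x m]).
exact: (closed_borel (@closed_complex1 (x m))).
Qed.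

Lemma measurable_countable_arrays (A : set (array_space R d)) : countable A -> measurable A.
Proof.
move=> /countable_injP[g gi].
have -> : A = \bigcup_n [set x | A x /\ g x = n].
  by apply/seteqP; split => [x Ax|x [n _ []]//]; exists (g x).
apply: bigcupT_measurable => n.
have [->|/set0P[x [Ax gx]]] := eqVneq [set x | A x /\ g x = n] set0; first by [].
rewrite (_ : [set _ | _] = [set x]); first exact: measurable_array1.
apply/seteqP; split => [y [Ay gy]|y ->//].
by apply: gi; rewrite ?inE// gx gy.
Qed.

End array_measurability.

(** * Periods of the atoms of the law *)

Section atoms.
Context d0 (T : measurableType d0) (R : realType) (P : probability T R).
Context (d : nat) (X : 'rV[int]_d -> T -> R[i]).
Hypothesis mX : forall m, measurable_fun [set: T] (X m : T -> borel R[i]).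

Lemma measurable_sample : measurable_fun [set: T] (sample X).
Proof.
apply: (@measurability _ _ T (array_space R d) setT (sample X) (@cylinders R d) erefl).
move=> _ [_ [m [B mB ->]] <-]; exact: mX.
Qed.

Lemma measurable_sample_preimage (A : set (array_space R d)) :
  measurable A -> measurable (sample X @^-1` A).
Proof. by move=> mA; have := measurable_sample measurableT mA; rewrite setTI. Qed.

Definition mass (x : 'rV[int]_d -> R[i]) : \bar R := P (sample X @^-1` [set x]).

Lemma measurable_fiber (x : array_space R d) : measurable (sample X @^-1` [set x]).
Proof. exact: (measurable_sample_preimage (@measurable_array1 R d x)). Qed.

(** The arrays of [A] with zero mass are countably many, so they form a null event; [g] numbers
    them. *)
Lemma atomic_law (A : set ('rV[int]_d -> R[i])) : countable A ->
  P.-negligible [set w | ~ A (X ^~ w)] ->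
  P.-negligible [set w | ~ (0 < mass (X ^~ w))%E].
Proof.
move=> /countable_injP[g gi] nA.
pose M n := [set w | [/\ A (X ^~ w), mass (X ^~ w) = 0%E & g (X ^~ w) = n]].
have : P.-negligible ([set w | ~ A (X ^~ w)] `|` \bigcup_n M n).
  apply: negligibleU => //; apply: negligible_bigcup => n.
  have [->|/set0P[w0 [A0 m0 g0]]] := eqVneq (M n) set0; first exact: negligible_set0.
  apply: (@negligibleS _ _ _ P (sample X @^-1` [set X ^~ w0])).
    move=> w [Aw mw gw] /=; apply: gi; rewrite ?inE//.
    by rewrite g0 -gw.
  by apply/negligibleP => //; exact: measurable_fiber.
apply: negligibleS => w /= mw.
have [Aw|Aw] := pselect (A (X ^~ w)); [right|by left].
exists (g (X ^~ w)) => //; split => //.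
by apply/eqP; rewrite -measure_le0 leNgt; apply/negP.
Qed.

Hypothesis X_stationary : strongly_stationary P X.

Lemma mass_translate m x : mass (translate m x) = mass x.
Proof.
have := X_stationary (- m) (@measurable_array1 R d x).
rewrite /pushforward -/(mass x) => <-; congr (P _).
apply/seteqP; split => w /= wx.
  by rewrite wx; apply/funext => n; rewrite /translate /sample addrNK.
by rewrite -wx; apply/funext => n; rewrite /translate /sample addrK.
Qed.

Definition has_period (x : 'rV[int]_d -> R[i]) (v : 'rV[int]_d) := is_N_periodic v x.

Lemma has_periodD x v v' : has_period x v -> has_period x v' -> has_period x (v + v').
Proof. by move=> xv xv' m; rewrite addrA xv' xv. Qed.

Lemma has_periodMn x v n : has_period x v -> has_period x (v *+ n).
Proof.
move=> xv; elim: n => [|n IHn]; first by move=> m; rewrite addr0.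
by rewrite mulrS; exact: has_periodD.
Qed.

(** The translates of [x] along multiples of [v] have the same mass; were they all distinct, their
    total mass would exceed 1. *)
Lemma atom_period x (v : 'rV[int]_d) : (0 < mass x)%E ->
  exists2 n : nat, (0 < n)%N & has_period x (v *+ n).
Proof.
move=> x0; pose y k := translate (v *+ k) x.
have [[k [l [kl ykl]]]|H] := pselect (exists k l, (k < l)%N /\ y k = y l).
  exists (l - k)%N; first by rewrite subn_gt0.
  move=> m; have := congr1 (fun f => f (m - v *+ k)) ykl.
  rewrite /y /translate addrNK => ->; congr (x _).
  by rewrite mulrnBr ?(ltnW kl)// addrA addrAC.
exfalso.
have yinj k l : y k = y l -> k = l.
  move=> ykl; case: (ltngtP k l) => // lt; exfalso; apply: H.
    by exists k, l.
  by exists l, k.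
have mE k : measurable (sample X @^-1` [set y k]) := measurable_fiber (y k).
have tE : trivIset setT (fun k => sample X @^-1` [set y k]).
  by move=> k l _ _ [w [/= wk wl]]; apply: yinj; rewrite -wk -wl.
have fin : mass x \is a fin_num by rewrite fin_num_measure//; exact: measurable_fiber.
pose p := fine (mass x).
have pE : mass x = p%:E by rewrite fineK.
have p0 : 0 < p by rewrite -lte_fin -pE.
have bound n : (n%:R * p <= 1)%R.
  have : (P (\big[setU/set0]_(k < n) (sample X @^-1` [set y k])) <= 1)%E.
    by apply: probability_le1; exact: bigsetU_measurable.
  rewrite (@measure_semi_additive_ord_I _ T R P (fun k => sample X @^-1` [set y k]))//; last exact: bigsetU_measurable.
    rewrite (eq_bigr (fun=> p%:E)); last first.
      by move=> k _; rewrite -pE -(mass_translate (v *+ k) x).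
    by rewrite sumEFin lee_fin sumr_const card_ord mulr_natl.
  exact: sub_trivIset tE.
have := bound (Num.truncn p^-1).+1.
rewrite -ler_pdivlMr// div1r leNgt truncnS_gt//.
Qed.

(** The product of the periods along the axes serves for every axis. *)
Lemma atom_periodic x : (0 < mass x)%E -> exists2 N : nat, (0 < N)%N &
  forall j, has_period x (delta_mx 0 j *+ N).
Proof.
move=> x0; pose n j := s2val (cid2 (atom_period (delta_mx 0 j) x0)).
have n0 j : (0 < n j)%N := s2valP (cid2 (atom_period (delta_mx 0 j) x0)).
have nP j : has_period x (delta_mx 0 j *+ n j) := s2valP' (cid2 (atom_period (delta_mx 0 j) x0)).
exists (\prod_j n j)%N; first by apply: prodn_gt0.
move=> j; rewrite (bigD1 j)//= mulrnA; exact: has_periodMn.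
Qed.

Lemma has_period_const x (N : nat) : (forall j, has_period x (delta_mx 0 j *+ N)) ->
  has_period x (const_mx N%:Z).
Proof.
move=> H; have -> : const_mx N%:Z = \sum_j delta_mx 0 j *+ N :> 'rV[int]_d.
  rewrite [LHS]row_sum_delta; apply: eq_bigr => j _; rewrite mxE.
  by apply/rowP => i; rewrite !mxE mulmxnE mxE; lia.
elim/big_ind : _ => [m| |//]; first by rewrite addr0.
exact: has_periodD.
Qed.

Lemma atom_is_periodic x : (0 < mass x)%E -> is_periodic x.
Proof.
move=> /atom_periodic[N N0 /has_period_const xN]; exists (const_mx N%:Z) => // j.
by rewrite mxE.
Qed.

(** The orbit [O] of one atom is countable, hence measurable, invariant and of positive probability,
    so of probability 1 by ergodicity. All arrays of the orbit share their periods. *)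
Lemma ergodic_period : ergodic P X -> P.-negligible [set w | ~ (0 < mass (X ^~ w))%E] ->
  exists2 N : nat, (0 < N)%N &
    P.-negligible [set w | ~ forall j, has_period (X ^~ w) (delta_mx 0 j *+ N)].
Proof.
move=> Xerg Xatom.
have [w0 w0P] : exists w, (0 < mass (X ^~ w))%E.
  apply: contrapT => /forallNP H.
  have : P.-negligible [set: T] by apply: negligibleS Xatom => w _; exact: H.
  move/negligibleP => /(_ measurableT) PT0.
  by have /eqP := etrans (esym PT0) (probability_setT P); rewrite eq_sym onee_eq0.
have [N N0 NP] := atom_periodic w0P; exists N => //.
pose O : set (array_space R d) := [set translate m (X ^~ w0) | m in [set: 'rV[int]_d]].
have cO : countable O by apply: sub_countable (card_image_le _ _) _; exact: countableP.
have mO : measurable O := measurable_countable_arrays cO.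
have Oinv m : O = [set translate m x | x in O].
  apply/seteqP; split => [_ [n _ <-]|_ [_ [n _ <-] <-]].
    exists (translate (n - m) (X ^~ w0)); first by exists (n - m).
    by apply/funext => k; rewrite /translate -addrA [m + _]addrC addrNK.
  exists (m + n) => //; apply/funext => k; rewrite /translate.
  by rewrite addrA.
have PO : P (sample X @^-1` O) = 1%E.
  have [P0|//] := Xerg O mO Oinv.
  move: w0P; rewrite ltNge => /negP; case.
  rewrite -P0 le_measure ?inE//; first exact: measurable_fiber.
    exact: measurable_sample_preimage.
  by move=> w /= ->; exists 0 => //; apply/funext => k; rewrite /translate addr0.
have : P.-negligible (~` (sample X @^-1` O)).
  have mpre := measurable_sample_preimage mO.
  apply/negligibleP; first exact: measurableC.
  by have := probability_setC P mpre; rewrite PO subee.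
apply: negligibleS => w /= wN [m _ Om]; apply: wN => j.
have H : has_period (translate m (X ^~ w0)) (delta_mx 0 j *+ N).
  by move=> k; rewrite /translate addrAC; exact: NP.
by rewrite Om in H.
Qed.

End atoms.

(** * Energy of the realisations without a given period *)

Section aperiodic_part.
Context d0 (T : measurableType d0) (R : realType) (P : probability T R).
Context (d : nat) (X : 'rV[int]_d -> T -> R[i]).
Hypothesis X_field : random_field P X.
Hypothesis X_stationary : strongly_stationary P X.

Let mX m : measurable_fun [set: T] (X m : T -> borel R[i]).
Proof. by case: (X_field m). Qed.

Let cmX m : cmeasurable (X m) := cmeasurable_field X_field m.

Definition grid_periodic (N : nat) : set (array_space R d) :=
  [set x | forall j, has_period x (delta_mx 0 j *+ N)].

Lemma measurable_coordinate_eq (m n : 'rV[int]_d) :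
  measurable ([set x | x m = x n] : set (array_space R d)).
Proof.
have [re1 im1] := cmeasurable_coordinate R m.
have [re2 im2] := cmeasurable_coordinate R n.
have -> : ([set x | x m = x n] : set (array_space R d)) =
   (fun x : array_space R d => complex.Re (x m) - complex.Re (x n)) @^-1` [set 0] `&`
   (fun x : array_space R d => complex.Im (x m) - complex.Im (x n)) @^-1` [set 0].
  apply/seteqP; split => [x /= ->|x /= [/eqP + /eqP]]; first by rewrite !subrr.
  rewrite !subr_eq0; case: (x m) (x n) => a b [a' b'] /=.
  by move=> /eqP -> /eqP ->.
by apply: measurableI; rewrite -[X in measurable X]setTI;
  apply: measurable_funB => //; exact: measurable_set1.
Qed.

Lemma measurable_grid_periodic N : measurable (grid_periodic N).
Proof.
apply: measurable_countable_forall => j; apply: measurable_countable_forall => m.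
exact: measurable_coordinate_eq.
Qed.

Lemma grid_periodic_translate N m x :
  grid_periodic N (translate m x) <-> grid_periodic N x.
Proof.
split=> xN j n; last by rewrite /translate addrAC; exact: xN.
by have := xN j (n - m); rewrite /translate addrAC !subrK.
Qed.

Definition aperiodic (N : nat) : set T := sample X @^-1` (~` grid_periodic N).

Lemma measurable_aperiodic N : measurable (aperiodic N).
Proof.
apply: measurable_sample_preimage => //.
exact: (measurableC (measurable_grid_periodic N)).
Qed.

Definition aperiodic_energy (N : nat) : \bar R :=
  (\int[P]_(w in aperiodic N) (modulus (X 0 w) ^+ 2)%:E)%E.

Lemma measurable_energy m (D : set T) : measurable_fun D (fun w => (modulus (X m w) ^+ 2)%:E).
Proof.
apply: (@measurable_funS _ _ _ _ setT) => //.
by apply/measurable_EFinP; exact: measurable_sqr_modulus.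
Qed.

(** Lack of the period is invariant under translations, so a change of variables reduces this to
    stationarity. *)
Lemma aperiodic_energy_shift N m :
  (\int[P]_(w in aperiodic N) (modulus (X m w) ^+ 2)%:E)%E = aperiodic_energy N.
Proof.
pose f (x : array_space R d) : \bar R := (modulus (x 0) ^+ 2)%:E.
have mD : measurable (~` grid_periodic N) by exact: (measurableC (measurable_grid_periodic N)).
have mf : measurable_fun (~` grid_periodic N) f.
  apply: (@measurable_funS _ _ _ _ setT) => //.
  apply/measurable_EFinP; apply: measurable_sqr_modulus; exact: cmeasurable_coordinate.
have f0 : {in ~` grid_periodic N, forall y, (0 <= f y)%E}.
  by move=> y _; rewrite lee_fin sqr_ge0.
have ms := measurable_sample mX.
have mt : measurable_fun [set: T] (fun w => translate m (sample X w) : array_space R d).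
  exact: (@measurable_sample _ T R d (fun n => X (n + m))).
have := ge0_integral_pushforward ms P mD mf f0.
have := ge0_integral_pushforward mt P mD mf f0.
have -> : (fun w => translate m (sample X w) : array_space R d) @^-1` (~` grid_periodic N)
    = aperiodic N.
  have H w := grid_periodic_translate N m (sample X w).
  by apply/seteqP; split => w /= wN /H.
rewrite /aperiodic_energy -/(aperiodic N) => E1 E2.
transitivity (\int[P]_(w in aperiodic N) (f \o (fun w => translate m (sample X w))) w)%E.
  by apply: eq_integral => w _; rewrite /f /= /translate /sample add0r.
rewrite -E1.
transitivity (\int[P]_(w in aperiodic N) (f \o sample X) w)%E; last by [].
rewrite -E2; apply: eq_measure_integral => A mA _.
exact: X_stationary.
Qed.

Lemma integrable_energy m : P.-integrable [set: T] (fun w => (modulus (X m w) ^+ 2)%:E).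
Proof.
apply/integrableP; split; first exact: measurable_energy.
have [_ + _] := X_field m; rewrite unlock; apply: le_lt_trans.
rewrite le_eqVlt; apply/orP; left; apply/eqP; apply: eq_integral => w _.
by rewrite gee0_abs// lee_fin sqr_ge0.
Qed.

Lemma integrable_dominated (f : T -> R) m : measurable_fun [set: T] f ->
  (forall w, `|f w| <= modulus (X m w)) -> P.-integrable [set: T] (EFin \o f).
Proof.
move=> mf fX.
apply: (@le_integrable _ T R P setT measurableT _ (fun w => (1 + modulus (X m w) ^+ 2)%:E)).
- exact/measurable_EFinP.
- move=> w _; rewrite /= lee_fin; apply: le_trans (fX w) _.
  rewrite [leRHS]ger0_norm ?addr_ge0 ?sqr_ge0//.
  by have := sqr_ge0 (modulus (X m w) - 1); have := modulus_ge0 (X m w); rewrite sqrrB; lra.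
- under eq_fun do rewrite EFinD.
  apply: integrableD => //; last exact: integrable_energy.
  by apply: finite_measure_integrable_cst.
Qed.

Lemma cmean_diff m n (Y : T -> R[i]) : (forall w, Y w = X m w - X n w) -> cmean P Y = 0.
Proof.
move=> YE; have [re1 im1] := cmX m; have [re2 im2] := cmX n.
have [_ _ /eqP] := X_field m; have [_ _ /eqP] := X_field n.
rewrite !eq_complex /= => /andP[/eqP ren /eqP imn] /andP[/eqP rem /eqP imm].
have key (g : R[i] -> R) : (forall a b, g (a - b) = g a - g b) ->
    (forall k, measurable_fun [set: T] (fun w => g (X k w))) ->
    (forall z, `|g z| <= modulus z) ->
    fine 'E_P[fun w => g (X m w)] = 0 -> fine 'E_P[fun w => g (X n w)] = 0 ->
    fine 'E_P[fun w => g (Y w)] = 0.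
  move=> gB mg gle gm gn.
  have im : P.-integrable [set: T] (EFin \o (fun w => g (X m w))).
    exact: (@integrable_dominated _ m).
  have in' : P.-integrable [set: T] (EFin \o (fun w => g (X n w))).
    exact: (@integrable_dominated _ n).
  move: gm gn; rewrite unlock => gm gn.
  rewrite (_ : (fun w => (g (Y w))%:E) = (fun w => (g (X m w))%:E - (g (X n w))%:E)%E); last first.
    by apply/funext => w; rewrite YE gB EFinB.
  rewrite integralB_EFin// fineB ?gm ?gn ?subrr//; exact: integrable_fin_num.
rewrite /cmean; congr (_ +i* _).
  apply: (key (@complex.Re R)) => //.
  - by case=> a b [].
  - by move=> k; case: (cmX k).
  - exact: normRe_le_modulus.
apply: (key (@complex.Im R)) => //.
- by case=> a b [].
- by move=> k; case: (cmX k).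
- exact: Im_le_modulus.
Qed.

(** Off [aperiodic N] the two values coincide; on it [|a - b|^2 <= 2 |a|^2 + 2 |b|^2], and both
    terms have the same energy by [aperiodic_energy_shift]. *)
Lemma cvariance_diff_le N j k :
  (cvariance P (fun w => \sum_(p <- [:: (1, 0); (-1, (delta_mx 0 j *+ (N * k))%R)]) p.1 * X p.2 w)%R
    <= 4%:E * aperiodic_energy N)%E.
Proof.
set m := (delta_mx 0 j *+ (N * k))%R; set Y := (X in cvariance P X).
have YE w : Y w = X 0 w - X m w.
  by rewrite /Y !big_cons big_nil /= addr0 mul1r mulN1r.
rewrite /cvariance (cmean_diff YE) unlock.
have mA := measurable_aperiodic N.
have mY (D : set T) : measurable_fun D (fun w => (modulus (Y w - 0) ^+ 2)%:E).
  apply: (@measurable_funS _ _ _ _ setT) => //.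
  apply/measurable_EFinP; apply: measurable_sqr_modulus.
  rewrite (_ : (fun w => _) = (fun w => X 0 w + (-1) * X m w)).
    by apply: cmeasurableD => //; exact: cmeasurableZ.
  by apply/funext => w; rewrite subr0 YE mulN1r.
have dA : [disjoint aperiodic N & ~` aperiodic N] by apply/disj_setPCl.
have Y0 w : (aperiodic N `|` ~` aperiodic N) w -> (0 <= (modulus (Y w - 0) ^+ 2)%:E)%E.
  by move=> _; rewrite lee_fin sqr_ge0.
rewrite -(setUv (aperiodic N)).
rewrite (@ge0_integral_setU _ T R P _ _ mA (measurableC mA) _ (mY _) Y0 dA).
rewrite [X in (_ + X <= _)%E]integral0_eq ?adde0; last first.
  move=> w /= /contrapT/(_ j)/(has_periodMn k)/(_ 0).
  rewrite -mulrnA add0r -/m YE /sample => ->.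
  by rewrite subrr subr0 ComplexField.Normc.normc0 expr0n.
apply: (@le_trans _ _ (\int[P]_(w in aperiodic N)
    (2%:E * (modulus (X 0 w) ^+ 2)%:E + 2%:E * (modulus (X m w) ^+ 2)%:E))%E).
  apply: ge0_le_integral => //.
  - by move=> w _; rewrite lee_fin sqr_ge0.
  - by apply: emeasurable_funD; apply: measurable_funeM; exact: measurable_energy.
  - move=> w _; rewrite -!EFinM -EFinD lee_fin subr0 YE !sqr_modulus.
    move: (X 0 w) (X m w) => [a b] [a' b'] /=.
    by have := sqr_ge0 (a + a'); have := sqr_ge0 (b + b'); rewrite !sqrrB !sqrrD; lra.
rewrite ge0_integralD//; last 4 first.
- by move=> w _; rewrite -EFinM lee_fin mulr_ge0 ?sqr_ge0.
- by apply: measurable_funeM; exact: measurable_energy.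
- by move=> w _; rewrite -EFinM lee_fin mulr_ge0 ?sqr_ge0.
- by apply: measurable_funeM; exact: measurable_energy.
rewrite !ge0_integralZl_EFin//; try by [exact: measurable_energy|move=> w _; rewrite lee_fin sqr_ge0].
rewrite !aperiodic_energy_shift -ge0_muleDl// -EFinD.
by rewrite (_ : 2 + 2 = 4 :> R)//; ring.
Qed.

(** Factorials are eventually multiples of any period, so each periodic realisation eventually
    leaves the aperiodic events; convergence is dominated by the squared modulus of [X 0]. *)
Lemma aperiodic_energy_cvg0 : P.-negligible [set w | ~ (0 < mass P X (X ^~ w))%E] ->
  (fun n => aperiodic_energy n`!) @ \oo --> 0%E.
Proof.
move=> Xatom.
pose f n w := ((fun w => (modulus (X 0 w) ^+ 2)%:E) \_ (aperiodic n`!)) w : \bar R.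
have fE : (fun n => aperiodic_energy n`!) = (fun n => \int[P]_(w in setT) f n w)%E.
  by apply/funext => n; rewrite /aperiodic_energy integral_mkcond.
have f0 n w : (0 <= f n w)%E.
  by rewrite /f patchE; case: ifP => // _; rewrite lee_fin sqr_ge0.
have mf n : measurable_fun [set: T] (f n).
  apply/(measurable_restrictT _ (measurable_aperiodic _)).
  exact: measurable_energy.
have fcvg : {ae P, forall w, [set: T] w -> f ^~ w @ \oo --> cst 0%E w}.
  apply: negligibleS Xatom => w /= wf; apply: contra_not wf => w0 _.
  have [N N0 wN] := atom_periodic mX X_stationary w0.
  apply: cvg_near_cst; exists N => // n /= Nn; rewrite /f patchE ifF//.
  apply/negbTE/negP => /set_mem; apply => j.
  have /dvdnP[q ->] : (N %| n`!)%N by rewrite dvdn_fact// N0.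
  by rewrite mulnC mulrnA; apply: has_periodMn; exact: wN.
have fdom : {ae P, forall w n, [set: T] w -> (`|f n w| <= (modulus (X 0 w) ^+ 2)%:E)%E}.
  apply: (@negligibleS _ _ _ P set0); last exact: negligible_set0.
  move=> w /=; apply => n _; rewrite gee0_abs ?f0// /f patchE; case: ifP => // _.
  by rewrite lee_fin sqr_ge0.
have [_ _] := @dominated_convergence _ T R P setT measurableT f (cst 0%E)
  _ mf (measurable_cst _) fcvg (integrable_energy 0) fdom.
by rewrite integral_cst// mul0e fE.
Qed.

Lemma aperiodic_energy_eq0 N :
  P.-negligible [set w | ~ forall j, has_period (X ^~ w) (delta_mx 0 j *+ N)] ->
  aperiodic_energy N = 0%E.
Proof.
move=> XN; have mA := measurable_aperiodic N.
have P0 : P (aperiodic N) = 0%E by exact/(@negligibleP _ T R P).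
by apply: null_set_integral => //; exact: measurable_energy.
Qed.

End aperiodic_part.

(** * Torsion points of the torus *)

Section torsion.
Variables (R : realType) (d : nat).

Lemma torus_expMn (u : torus R d) k n : torus_exp u (k *+ n) = torus_exp u k ^+ n.
Proof.
elim: n => [|n IHn]; first by rewrite torus_exp0 expr0.
by rewrite mulrS torus_expD IHn exprS.
Qed.

Lemma torus_exp_delta (u : torus R d) j : torus_exp u (delta_mx 0 j) = set_val u 0 j.
Proof.
rewrite /torus_exp (bigD1 j)//= mxE !eqxx expr1z big1 ?mulr1// => i ij.
by rewrite mxE (negbTE ij) andbF expr0z.
Qed.

Lemma continuous_coord_pow (N : nat) (j : 'I_d) :
  continuous (fun u : torus R d => modulus (1 - set_val u 0 j ^+ N) ^+ 2).
Proof.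
apply: continuous_sqr_modulus.
have := @trig_ccontinuous R d setT (fun u => 1 - set_val u 0 j ^+ N); apply.
exists [:: (1, 0); (-1, delta_mx 0 j *+ N)] => // v.
rewrite !big_cons big_nil /= addr0 torus_exp0 mul1r mulN1r.
by rewrite torus_expMn torus_exp_delta.
Qed.

Lemma sqr_modulus_1B (z : R[i]) : modulus z = 1 ->
  modulus (1 - z) ^+ 2 = 2 - 2 * complex.Re z.
Proof.
move=> z1; have := sqr_modulus z; rewrite z1 expr1n sqr_modulus.
by case: z {z1} => a b /= E; rewrite !(oppr0, add0r) sqrrN -[b ^+ 2](addKr (a ^+ 2)) -E; ring.
Qed.

(* The sum is 2 M minus twice the real part of a geometric sum, which is at most
   2 / e in modulus. *)
Lemma sum_sqr_modulus_ge (z : R[i]) (e : R) (M : nat) : modulus z = 1 -> 0 < e ->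
  e <= modulus (1 - z) -> 4 / e <= M%:R ->
  M%:R <= \sum_(k < M) modulus (1 - z ^+ k) ^+ 2.
Proof.
move=> z1 e0 ez eM.
have zk k : modulus (z ^+ k) = 1 by rewrite modulusX z1 expr1n.
under eq_bigr do rewrite sqr_modulus_1B//.
rewrite sumrB sumr_const card_ord -mulr_sumr -Re_sum.
set g := \sum_(k < M) z ^+ k.
have gE : (1 - z) * g = 1 - z ^+ M by rewrite -opprB mulNr -subrX1 opprB.
have g2 : modulus g <= 2 / e.
  rewrite ler_pdivlMr// mulrC; apply: (@le_trans _ _ (modulus (1 - z) * modulus g)).
    by rewrite ler_wpM2r ?modulus_ge0.
  rewrite -ComplexField.Normc.normcM gE (le_trans (modulusD _ _))//.
  by rewrite normcN zk ComplexField.Normc.normc1.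
have := Re_le_modulus g.
have e4 : 4 / e = 2 * (2 / e) :> R by field; rewrite gt_eqF.
rewrite e4 in eM.
by rewrite -[2 *+ M]mulr_natl; lra.
Qed.

Definition torsion_points (N : nat) : set (torus R d) :=
  [set u : torus R d | forall j, set_val u 0 j ^+ N = 1].

Lemma finite_torsion_points N : (0 < N)%N -> finite_set (torsion_points N).
Proof.
move=> N0.
(* The coordinates of torsion points lie in the list [rs] of roots of [X^N - 1]. *)
have [rs rsE] := closed_field_poly_normal ('X^N - 1 : {poly R[i]}).
(* [get] yields an arbitrary point when no point of the torus has these coordinates; it suffices
   that the image of [h] contains all torsion points. *)
pose h (k : {ffun 'I_d -> 'I_(size rs).+1}) : torus R d :=
  get [set u : torus R d | forall j, set_val u 0 j = rs`_(k j)].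
apply: (sub_finite_set _ (finite_image h (@finite_finset _ [set: {ffun 'I_d -> 'I_(size rs).+1}]))).
move=> u uN.
have urs j : set_val u 0 j \in rs.
  have : root ('X^N - 1) (set_val u 0 j).
    by rewrite rootE !hornerE uN subrr.
  rewrite rsE lead_coefXnsubC// scale1r root_prod_XsubC; exact.
exists [ffun j => inord (index (set_val u 0 j) rs)] => //.
have uP j : set_val u 0 j = rs`_([ffun j => inord (index (set_val u 0 j) rs)] j : 'I_(size rs).+1).
  by rewrite ffunE inordK ?nth_index// ltnS index_size.
have hP := @getPex _ [set v : torus R d | forall j, set_val v 0 j =
  rs`_([ffun j => inord (index (set_val u 0 j) rs)] j : 'I_(size rs).+1)] (ex_intro _ u uP).
by apply/val_inj/rowP => j; rewrite hP uP.
Qed.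

End torsion.

(** * Spectral mass off the torsion points *)

Section spectral_atoms.
Context d0 (T : measurableType d0) (R : realType) (P : probability T R).
Context (d : nat) (X : 'rV[int]_d -> T -> R[i]).
Variable S : {finite_measure set (borel (torus R d)) -> \bar R}.
Hypothesis X_field : random_field P X.
Hypothesis X_stationary : strongly_stationary P X.
Hypothesis X_spectral : is_spectral_measure P X S.

Lemma closed_coord_pow (N : nat) (j : 'I_d) (e : R) :
  closed [set u : torus R d | e <= modulus (1 - set_val u 0 j ^+ N) ^+ 2].
Proof.
apply: (@closed_comp _ _ (fun u : torus R d => modulus (1 - set_val u 0 j ^+ N) ^+ 2)
  [set x | e <= x]); last exact: closed_ge.
by move=> u _; exact: continuous_coord_pow.
Qed.

(** The 4 comes from [cvariance_diff_le] and [c] from the spectral identity. The constant is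
    independent of [N] and [j], so the mass vanishes along with the energy. *)
Lemma spectral_mass_off_torsion : exists2 C : R, 0 <= C & forall (N : nat) (j : 'I_d),
  (S [set u : torus R d | (set_val u 0 j ^+ N != 1)%R]
     <= C%:E * aperiodic_energy P X N)%E.
Proof.
pose c : R := (2 * pi) ^- d.
have c0 : 0 < c by rewrite invr_gt0 exprn_gt0// mulr_gt0// pi_gt0.
exists (4 / c); first by rewrite divr_ge0// ltW.
move=> N j; set t := aperiodic_energy P X N.
have t0 : (0 <= t)%E by apply: integral_ge0 => w _; rewrite lee_fin sqr_ge0.
pose f k (u : borel (torus R d)) : \bar R := (modulus (1 - (set_val u 0 j ^+ N) ^+ k) ^+ 2)%:E.
pose s k : seq (R[i] * 'rV[int]_d) := [:: (1, 0); (-1, delta_mx 0 j *+ (N * k))].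
have fE k : f k = fun u => ((modulus (fourier (coefs (s k)) u) ^+ 2)%:E).
  apply/funext => u; rewrite /f fourier_coefs !big_cons big_nil /= addr0.
  by rewrite torus_exp0 mul1r mulN1r mulrnA !torus_expMn torus_exp_delta.
have mf k : measurable_fun [set: borel (torus R d)] (f k).
  by rewrite fE; exact: measurable_fourier.
have f0 k u : (0 <= f k u)%E by rewrite lee_fin sqr_ge0.
have fle k : (c%:E * \int[S]_u f k u <= 4%:E * t)%E.
  have := cvariance_diff_le X_field X_stationary N j k.
  by rewrite (cvariance_coefs X_spectral) fE.
(* The sets [E n] increase to the whole set; on each of them the sum of the first [M] densities
   [f k] is at least [M], for a suitable [M]. *)
pose E n := [set u : torus R d | n.+1%:R^-1 ^+ 2 <= modulus (1 - set_val u 0 j ^+ N) ^+ 2].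
have mE n : measurable (E n : set (borel (torus R d))).
  exact: (@closed_borel (torus R d) _ (@closed_coord_pow N j (n.+1%:R^-1 ^+ 2))).
have SE n : (S (E n) <= (4 / c)%:E * t)%E.
  pose e : R := n.+1%:R^-1.
  have e0 : 0 < e by rewrite invr_gt0 ltr0n.
  pose M := (Num.truncn (4 / e)).+1.
  have M0 : 0 < M%:R :> R by rewrite ltr0n.
  have eM : 4 / e <= M%:R by rewrite ltW// truncnS_gt.
  have H1 : (M%:R%:E * S (E n) <= \int[S]_u (\sum_(k < M) f k u))%E.
    rewrite -integral_cst//.
    apply: (@le_trans _ _ (\int[S]_(u in E n) (\sum_(k < M) f k u))%E).
      apply: ge0_le_integral => //.
      - by move=> u _; rewrite lee_fin ltW.
      - by apply: emeasurable_sum => k; exact: measurable_funS (mf k).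
      - move=> u Eu; rewrite sumEFin lee_fin.
        have {}Eu : e ^+ 2 <= modulus (1 - set_val u 0 j ^+ N) ^+ 2 := Eu.
        have [th thu _] := tor_surj u.
        apply: (@sum_sqr_modulus_ge R _ e) => //.
          by rewrite -thu torE modulusX modulus_cis expr1n.
        by move: Eu; rewrite ler_pXn2r ?nnegrE ?modulus_ge0// ltW.
    apply: ge0_subset_integral => //.
      by apply: emeasurable_sum => k; exact: mf.
    by move=> u _; apply: sume_ge0 => k _; exact: f0.
  have H2 : (c%:E * (M%:R%:E * S (E n)) <= M%:R%:E * (4%:E * t))%E.
    apply: (@le_trans _ _ (c%:E * \int[S]_u (\sum_(k < M) f k u))%E).
      by rewrite lee_wpmul2l// lee_fin ltW.
    rewrite ge0_integral_sum// ge0_sume_distrr; last by move=> k _; exact: integral_ge0.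
    apply: (@le_trans _ _ (\sum_(k < M) (4%:E * t))%E); first exact: lee_sum.
    by rewrite sumr_const card_ord -[leLHS]mule_natl.
  move: H2; rewrite muleCA lee_pmul2l ?lte_fin// => H2.
  by rewrite mulrC EFinM -muleA lee_pdivlMl.
have -> : [set u : torus R d | set_val u 0 j ^+ N != 1] = \bigcup_n E n.
  apply/seteqP; split => [u /= u1|u [n _ uE]]; last first.
    apply/eqP => u1.
    have : n.+1%:R^-1 ^+ 2 <= modulus (1 - set_val u 0 j ^+ N) ^+ 2 := uE.
    by rewrite u1 subrr ComplexField.Normc.normc0 expr0n /= leNgt exprn_gt0// invr_gt0 ltr0n.
  have m0 : 0 < modulus (1 - set_val u 0 j ^+ N).
    rewrite lt_neqAle modulus_ge0 andbT eq_sym; apply/eqP.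
    move=> /ComplexField.Normc.eq0_normc/eqP; rewrite subr_eq0 => /eqP uN.
    by move: u1; rewrite -uN eqxx.
  have [n _ /(_ n (leqnn n)) Hn] := near_infty_natSinv_lt (PosNum m0).
  exists n => //; rewrite /E /mkset lerXn2r ?nnegrE ?modulus_ge0 ?invr_ge0//.
  exact: ltW.
have mU : measurable (\bigcup_n E n : set (borel (torus R d))) by exact: bigcupT_measurable.
have ndE : nondecreasing_seq (E : nat -> set (borel (torus R d))).
  move=> m n mn; apply/subsetPset => u /=; apply: le_trans.
  by rewrite lerXn2r ?nnegrE ?invr_ge0// lef_pV2 ?posrE ?ltr0n// ler_nat ltnS.
have cv := @nondecreasing_cvg_mu _ (borel (torus R d)) R S E mE mU ndE.
rewrite -(cvg_lim _ cv)//; apply: lime_le; first exact: cvgP cv.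
by apply: nearW => n; exact: SE.
Qed.

End spectral_atoms.

(** * Open sets and null sets around torsion points *)

Section torsion_support.
Variables (R : realType) (d : nat).
Variable S : {finite_measure set (borel (torus R d)) -> \bar R}.

Lemma open_off_torsion (N : nat) (j : 'I_d) :
  open [set u : torus R d | set_val u 0 j ^+ N != 1].
Proof.
have -> : [set u : torus R d | set_val u 0 j ^+ N != 1] =
    ~` [set u : torus R d | modulus (1 - set_val u 0 j ^+ N) ^+ 2 <= 0].
  apply/seteqP; split => u /=; last first.
    move=> u0; apply/eqP => u1; apply: u0.
    by rewrite u1 subrr ComplexField.Normc.normc0 expr0n.
  move=> u1 u0; move/eqP: u1; apply; apply/esym/eqP; rewrite -subr_eq0; apply/eqP.
  apply: ComplexField.Normc.eq0_normc; apply/eqP; rewrite -sqrf_eq0 eq_le u0.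
  by rewrite sqr_ge0.
rewrite openC.
apply: (@closed_comp _ _ (fun u : torus R d => modulus (1 - set_val u 0 j ^+ N) ^+ 2)
  [set x | x <= 0]); last exact: closed_le.
by move=> u _; exact: continuous_coord_pow.
Qed.

Lemma closed_torus1 (u : torus R d) : closed [set u].
Proof.
have [th <- _] := tor_surj u.
have -> : [set tor th] = @peak R d th @^-1` [set x | 1 <= x].
  apply/seteqP; split => w /=; first by move=> ->; rewrite peak_tor.
  by move=> w1; apply: peak_eq1; apply/le_anti; rewrite peak_le1.
by apply: closed_comp; [move=> w _; exact: continuous_peak|exact: closed_ge].
Qed.

Lemma countable_negligible (A : set (borel (torus R d))) : countable A ->
  (forall u, A u -> S [set u] = 0%E) -> S.-negligible A.
Proof.
move=> /countable_injP[g gi] A0.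
have -> : A = \bigcup_n [set u | A u /\ g u = n].
  by apply/seteqP; split => [u Au|u [n _ []]//]; exists (g u).
apply: (@negligible_bigcup _ (borel (torus R d)) R S) => n.
have [->|/set0P[u [Au gu]]] := eqVneq [set u | A u /\ g u = n] set0.
  exact: negligible_set0.
apply: (@negligibleS _ (borel (torus R d)) R S [set u]).
  by move=> v [Av gv]; apply: gi; rewrite ?inE// gu gv.
apply/(@negligibleP _ (borel (torus R d)) R S); last exact: A0.
exact: (@closed_borel (torus R d) _ (@closed_torus1 u)).
Qed.

End torsion_support.

(* Periodicity of the field and atomicity of the spectral measure *)
Local Close Scope complex_scope.

Theorem theorem7 (R : realType) (d0 : measure_display) (T : measurableType d0)
    (P : probability T R) (d : nat) (X : 'rV[int]_d -> T -> R[i])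
    (U : set R[i]) (S : {finite_measure set (borel (torus R d)) -> \bar R})
    (G : set (torus R d)) :
  random_field P X ->
  strongly_stationary P X ->
  uniformly_discrete U ->
  (forall m w, U (X m w)) ->
  is_spectral_measure P X S ->
  simply_connected R G ->
  measure_support S `<=` G ->
  [/\ {ae P, forall w, is_periodic (X ^~ w)},
      purely_atomic S &
      ergodic P X ->
        (exists2 N : nat, (0 < N)%N &
           {ae P, forall w, is_N_periodic (const_mx N%:Z) (X ^~ w)}) /\
        finite_set (measure_support S)].
Proof.
move=> X_field X_stat U_disc XU X_spec G_sc SG.
have Kline (v : 'rV[int]_d) : v != 0 -> forall th : 'rV[R]_d,
    exists s : R, ~ measure_support S (tor (th + s *: map_mx intr v)).
  by move=> v0 th; have [s sG] := simply_connected_no_line th G_sc v0; exists s => /SG.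
have mX m : measurable_fun [set: T] (X m : T -> borel R[i]) by case: (X_field m).
have [F [Fpast [mF [a [a0 [C [rho [C0 rho01 FC]]]]]]]] := prediction_error X_field X_spec Kline.
have [A cA XA] := countable_law_of_predictor U_disc XU Fpast mF a0 C0 rho01 FC.
have Xatom := atomic_law mX cA XA.
have [B B0 SB] := spectral_mass_off_torsion X_field X_stat X_spec.
split.
- apply: negligibleS Xatom => w /= wper; apply: contra_not wper.
  exact: atom_is_periodic.
- move=> E mE SE.
  (* The countable set [D] of torsion points carries [S], so a measurable set containing no point of
     positive mass is null. *)
  pose D := \bigcup_n @torsion_points R d n`!.
  have cD : countable D.
    apply: bigcup_countable => // n _; apply: finite_set_countable.
    by apply: finite_torsion_points; exact: fact_gt0.
  apply: contrapT => Eatom.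
  have ED : S.-negligible (E `&` D : set (borel (torus R d))).
    apply: countable_negligible.
      by apply: sub_countable cD; apply: subset_card_le => u [].
    move=> u [Eu _]; apply/eqP; rewrite -measure_le0 leNgt; apply/negP => u0.
    by apply: Eatom; exists u.
  (* The points with some coordinate that is not torsion of the given factorial order; their mass is
     controlled by an energy tending to 0. *)
  pose W n := \big[setU/set0]_(j <- enum 'I_d)
    ([set u : torus R d | set_val u 0 j ^+ n`! != 1] : set (borel (torus R d))).
  have mW n : measurable (W n).
    by apply: bigsetU_measurable => j _; exact: (@open_borel (torus R d) _ (@open_off_torsion R d n`! j)).
  have SW n : (S (W n) <= (size (enum 'I_d))%:R%:E * (B%:E * aperiodic_energy P X n`!))%E.
    apply: (@measure_bigsetU_le _ (borel (torus R d)) R S) => j; last exact: SB.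
    exact: (@open_borel (torus R d) _ (@open_off_torsion R d n`! j)).
  have DC : S.-negligible (~` D : set (borel (torus R d))).
    apply: (@negligibleS _ (borel (torus R d)) R S (\bigcap_n W n)).
      move=> u uD n _; apply: contrapT => uW; apply: uD; exists n => // j.
      apply: contrapT => /eqP uj; apply: uW.
      by rewrite /W -bigcup_seq; exists j => //=; rewrite mem_enum.
    have mcap : measurable (\bigcap_n W n) by exact: bigcapT_measurable.
    apply/(@negligibleP _ (borel (torus R d)) R S) => //.
    apply/eqP; rewrite -measure_le0.
    have lim0 : (fun n => (size (enum 'I_d))%:R%:E * (B%:E * aperiodic_energy P X n`!))%E
        @ \oo --> 0%E.
      rewrite -(mule0 (size (enum 'I_d))%:R%:E) -(mule0 B%:E).
      apply: cvgeZl => //; apply: cvgeZl => //.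
      exact: aperiodic_energy_cvg0.
    rewrite -(cvg_lim _ lim0)//; apply: lime_ge; first exact: cvgP lim0.
    apply: nearW => n; apply: le_trans (SW n).
    by apply: le_measure; rewrite ?inE//; apply: bigcap_inf.
  have : S.-negligible E.
    apply: (@negligibleS _ (borel (torus R d)) R S (E `&` D `|` ~` D)).
      by move=> u Eu; have [Du|Du] := pselect (D u); [left|right].
    exact: negligibleU.
  move/(@negligibleP _ (borel (torus R d)) R S E mE) => S0.
  by move: SE; rewrite lt0e S0 eqxx.
- move=> X_erg.
  have [N N0 XN] := ergodic_period mX X_stat X_erg Xatom.
  split.
    exists N => //; apply: negligibleS XN => w /= wN; apply: contra_not wN.
    exact: has_period_const.
  (* The energy vanishes for the common period [N], so the open set of points with a coordinate that
     is not [N]-torsion is null and misses the support. *)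
  apply: sub_finite_set (@finite_torsion_points R d N N0) => u uS j.
  apply: contrapT => /eqP uN.
  have := uS _ (@open_off_torsion R d N j) uN; rewrite ltNge => /negP; apply.
  by apply: le_trans (SB N j) _; rewrite (aperiodic_energy_eq0 X_field XN) mule0.
Qed.
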